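(* Fix $a\in(0,\tfrac12)$ and $\gamma\in(-\sqrt{2a(1-2a)},0)$. There exist $\lambda\in[-1-a,-1+a]$ and $E\in(0,1)$ such that, for these parameters, the $\Theta$-flow has a saddles connector and the $\Omega$-flow has a saddles connector (both as described in the context).
   Context: $\Theta$-flow: on $[0,\pi]\times\mathbb R$ ($\Theta$ mod $2\pi$ on the cylinder), $$\dot\theta=\sin\theta,\qquad \dot\Theta=-2a\sin\theta\cos\theta\cos\Theta+2aE\sin^2\theta\sin\Theta-\sin\Theta+2\lambda\sin\theta;$$ its saddles connector is an orbit in $(0,\pi)\times\mathbb R$ with $\alpha$-limit $(0,0)$ and $\omega$-limit $(\pi,-\pi)$. $\Omega$-flow: on $[-\tfrac\pi2,\tfrac\pi2]\times\mathbb R$ ($\Omega$ mod $2\pi$ on the cylinder), $$\dot\xi=\cos^2\xi,\qquad \dot\Omega=2a\sin\xi\cos\Omega+2\lambda\cos\xi\sin\Omega+2\gamma\sin\xi\cos\xi+\cos^2\xi-2aE;$$ with $\arccos$ the principal branch in $[0,\pi]$, its saddles connector is an orbit in the open strip with $\alpha$-limit $(-\tfrac\pi2,-\pi+\arccos E)$ and $\omega$-limit $(\tfrac\pi2,-\arccos E)$. (These are the angular and radial Prüfer equations of the separated Dirac equation on the zero-gravity Kerr–Newman spacetime with $\kappa=\tfrac12$, units $m=1$, $\gamma=-eQ$; a common pair $(E,\lambda)$ with both connectors yields a square-integrable bound state of energy $E$.) *)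

(* Defs.v *)
From Stdlib Require Import Reals Lra.
From Coquelicot Require Import Coquelicot.
Open Scope R_scope.

Definition Theta_rhs (a E lam th Th : R) : R :=
  - 2 * a * sin th * cos th * cos Th + 2 * a * E * (sin th)^2 * sin Th
  - sin Th + 2 * lam * sin th.

Definition Omega_rhs (a E lam gam xi Om : R) : R :=
  2 * a * sin xi * cos Om + 2 * lam * cos xi * sin Om
  + 2 * gam * sin xi * cos xi + (cos xi)^2 - 2 * a * E.

(** Saddles connector of the Theta-flow: an orbit (a global solution) lying in
    the open strip (0,pi) x R, tending to (0,0) as t -> -oo and to (pi,-pi)
    as t -> +oo (limits taken in the lift R of the angle Theta). *)
Definition Theta_connector (a E lam : R) : Prop :=
  exists th Th : R -> R,
    (forall t, 0 < th t < PI) /\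
    (forall t, is_derive th t (sin (th t))) /\
    (forall t, is_derive Th t (Theta_rhs a E lam (th t) (Th t))) /\
    is_lim th m_infty 0 /\ is_lim Th m_infty 0 /\
    is_lim th p_infty PI /\ is_lim Th p_infty (- PI).

Definition Omega_connector (a E lam gam : R) : Prop :=
  exists xi Om : R -> R,
    (forall t, - (PI / 2) < xi t < PI / 2) /\
    (forall t, is_derive xi t ((cos (xi t))^2)) /\
    (forall t, is_derive Om t (Omega_rhs a E lam gam (xi t) (Om t))) /\
    is_lim xi m_infty (- (PI / 2)) /\ is_lim Om m_infty (- PI + acos E) /\
    is_lim xi p_infty (PI / 2) /\ is_lim Om p_infty (- acos E).

(* Main.v *)
Require Import Defs.
From Stdlib Require Import Reals Lra Lia ClassicalEpsilon Ranalysis5.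
From Coquelicot Require Import Coquelicot.
Open Scope R_scope.

(** Along [theta = 2 atan (exp t)] and [xi = atan t] both flows become scalar
    equations [x' = A(t) cos x + B(t) sin x + C(t)] which, as [t -> -oo], have an
    exponentially attracting equilibrium; exactly one orbit emanates from it. The
    reflection [x(t) -> -PI - x(-t)] preserves the Theta-equation and exchanges
    [gam] and [-gam] in the Omega-equation. Hence the Theta-connector exists iff
    the emanating orbit equals [-PI/2] at [t = 0], and the Omega-connector exists
    iff the emanating orbits for [gam] and [-gam] add up to [-PI] at [t = 0].

    The value of the Theta-orbit at [0] increases with [lam], and the curve
    [-theta] is a barrier for it from below at [lam = -1 + a] and from above at
    [lam = -1 - a]; this gives a continuous function [lam(E)]. Along it the
    Omega-mismatch is positive at [E = 0] (constant barrier [-PI/2]). It is negative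
    for [E] close to [1]: the Coulomb term [2 gam sin xi cos xi], of order [1/t], has
    a divergent integral, so it pulls the orbit below the saddle at [-acos E]. The
    intermediate value theorem in [E] concludes. *)

(** * Differential inequalities and uniqueness *)

(** [auto_derive] leaves [Derive g t] for an abstract function [g]; the value comes from the
    hypothesis [H], with [g] and [x] compared only up to conversion. *)
Ltac replace_derive H :=
  match type of H with
  | is_derive ?x ?t ?l =>
      match goal with
      | |- context [Derive ?g t] =>
          replace (Derive g t) with l by (symmetry; apply is_derive_unique; exact H)
      end
  end.

Lemma derive_nonneg_le (g dg : R -> R) (a b : R) :
  a <= b ->
  (forall t, a <= t <= b -> is_derive g t (dg t)) ->
  (forall t, a <= t <= b -> 0 <= dg t) -> g a <= g b.
Proof.
  intros Hab Hd Hpos.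
  destruct (MVT_gen g a b dg) as [c [Hc Heq]];
    rewrite ?Rmin_left, ?Rmax_right in * by lra.
  - intros x Hx; apply Hd; lra.
  - intros x Hx; apply continuity_pt_filterlim.
    apply (ex_derive_continuous g x); exists (dg x); apply Hd; lra.
  - assert (0 <= dg c) by (apply Hpos; lra). nra.
Qed.

Lemma derive_pos_sign (d : R -> R) (t l : R) :
  is_derive d t l -> 0 < l -> d t = 0 ->
  exists e : R, 0 < e /\ forall h, 0 < h < e -> 0 < d (t + h) /\ d (t - h) < 0.
Proof.
  intros Hd Hl H0. apply is_derive_Reals in Hd.
  destruct (Hd (l / 2)) as [e He]; [lra|].
  exists e; split; [apply cond_pos|]. intros h Hh.
  assert (quot : forall k, k <> 0 -> Rabs k < e -> l / 2 < d (t + k) / k).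
  { intros k Hk Hke. specialize (He k Hk Hke). rewrite H0, Rminus_0_r in He.
    apply Rabs_def2 in He; lra. }
  split.
  - assert (Hq := quot h ltac:(lra) ltac:(rewrite Rabs_pos_eq; lra)).
    replace (d (t + h)) with (d (t + h) / h * h) by (field; lra). nra.
  - assert (Hq := quot (- h) ltac:(lra) ltac:(rewrite Rabs_Ropp, Rabs_pos_eq; lra)).
    replace (t - h) with (t + - h) by ring.
    replace (d (t + - h)) with (d (t + - h) / (- h) * (- h)) by (field; lra). nra.
Qed.

Lemma continuous_pos_near (d : R -> R) (t : R) :
  continuous d t -> 0 < d t ->
  exists e : R, 0 < e /\ forall u, Rabs (u - t) < e -> 0 < d u.
Proof.
  intros Hc Hp.
  destruct (proj1 (filterlim_locally d (d t)) Hc (mkposreal _ Hp)) as [e He].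
  exists e; split; [apply cond_pos|]. intros u Hu.
  specialize (He u Hu). simpl in He.
  unfold ball in He; simpl in He; unfold AbsRing_ball, abs, minus, plus, opp in He; simpl in He.
  apply Rabs_def2 in He; lra.
Qed.

(** Let [tau] be the supremum of the times with [0 <= d]. Continuity excludes [d tau < 0]. If
    [d tau = 0] the slope, and if [0 < d tau] continuity, gives such times beyond [tau] unless
    [tau = s]. The slope condition sits only at zeros of [d], which is what suits nonlinear
    equations. *)
Lemma barrier (d dd : R -> R) (T s : R) :
  T <= s ->
  (forall t, T <= t <= s -> is_derive d t (dd t)) ->
  (forall t, T <= t <= s -> d t = 0 -> 0 < dd t) ->
  0 <= d T -> 0 <= d s.
Proof.
  intros HTs Hd Hz H0. apply Rnot_lt_le; intros Hs.
  destruct (completeness (fun t => T <= t <= s /\ 0 <= d t)) as [tau [Hub Hlub]].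
  { exists s; intros t [Ht _]; lra. }
  { exists T; split; [lra|assumption]. }
  assert (HT : T <= tau) by (apply Hub; split; [lra|assumption]).
  assert (Hts : tau <= s) by (apply Hlub; intros t [Ht _]; lra).
  assert (Hcont : continuous d tau)
    by (apply (ex_derive_continuous d tau); exists (dd tau); apply Hd; lra).
  destruct (Rtotal_order (d tau) 0) as [Hn | [He | Hp]].
  - destruct (continuous_pos_near (fun t => - d t) tau) as [e [He Hnear]];
      [now apply (continuous_opp d) | lra |].
    assert (tau <= tau - e); [|lra].
    apply Hlub; intros t [Ht Hdt].
    assert (t <= tau) by (apply Hub; split; assumption).
    apply Rnot_lt_le; intros Hlt.
    assert (Hc := Hnear t ltac:(apply Rabs_def1; lra)); simpl in Hc; lra.
  - assert (Hne : tau <> s) by (intros E; subst; lra).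
    destruct (derive_pos_sign d tau (dd tau)) as [e [He' Hsign]];
      [apply Hd; lra | apply Hz; lra | assumption |].
    set (h := Rmin (e / 2) (s - tau)).
    assert (0 < h) by (unfold h; apply Rmin_pos; lra).
    assert (h <= e / 2) by apply Rmin_l.
    assert (h <= s - tau) by apply Rmin_r.
    destruct (Hsign h) as [Hp _]; [lra|].
    assert (tau + h <= tau) by (apply Hub; split; lra). lra.
  - assert (Hne : tau <> s) by (intros E; subst; lra).
    destruct (continuous_pos_near d tau Hcont Hp) as [e [He Hnear]].
    set (h := Rmin (e / 2) (s - tau)).
    assert (0 < h) by (unfold h; apply Rmin_pos; lra).
    assert (h <= e / 2) by apply Rmin_l.
    assert (h <= s - tau) by apply Rmin_r.
    assert (0 < d (tau + h)) by (apply Hnear; rewrite Rabs_pos_eq; lra).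
    assert (tau + h <= tau) by (apply Hub; split; lra). lra.
Qed.

(** A zero at [s] with positive slope would make [d] negative just before [s], against [barrier]. *)
Lemma barrier_strict (d dd : R -> R) (T s : R) :
  T < s ->
  (forall t, T <= t <= s -> is_derive d t (dd t)) ->
  (forall t, T <= t <= s -> d t = 0 -> 0 < dd t) ->
  0 <= d T -> 0 < d s.
Proof.
  intros HTs Hd Hz H0.
  assert (Hle : forall u, T <= u <= s -> 0 <= d u).
  { intros u Hu. apply (barrier d dd T u); try lra.
    - intros; apply Hd; lra.
    - intros; apply Hz; [lra|assumption]. }
  destruct (Hle s ltac:(lra)) as [Hs|Hs]; [assumption|exfalso].
  destruct (derive_pos_sign d s (dd s)) as [e [He Hsign]];
    [apply Hd; lra | apply Hz; [lra|now symmetry] | now symmetry |].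
  set (h := Rmin (e / 2) (s - T)).
  assert (0 < h) by (unfold h; apply Rmin_pos; lra).
  assert (h <= e / 2) by apply Rmin_l.
  assert (h <= s - T) by apply Rmin_r.
  destruct (Hsign h) as [_ Hneg]; [lra|].
  assert (0 <= d (s - h)) by (apply Hle; lra). lra.
Qed.

Lemma is_lim_m_infty_iff (x : R -> R) (l : R) :
  is_lim x m_infty l <->
  forall e, 0 < e -> exists T, forall t, t <= T -> Rabs (x t - l) < e.
Proof.
  split.
  - intros H e He. apply is_lim_spec in H.
    destruct (H (mkposreal e He)) as [M HM]. exists (M - 1).
    intros t Ht; apply HM; lra.
  - intros H. apply is_lim_spec. intros e.
    destruct (H e (cond_pos e)) as [T HT]. exists T. intros t Ht; apply HT; lra.
Qed.

Definition solves (f : R -> R -> R) (x : R -> R) : Prop :=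
  forall t, is_derive x t (f t (x t)).

Definition lipschitz (f : R -> R -> R) (L : R) : Prop :=
  forall t x y, Rabs (f t x - f t y) <= L * Rabs (x - y).

Lemma solves_continuous f x t : solves f x -> continuous x t.
Proof.
  intros H; apply (ex_derive_continuous x t); eexists; apply H.
Qed.

(** Gronwall: the Lipschitz bound makes [(x - y)^2 exp (- 2 L s)] nonincreasing, and it vanishes at
    [t0]. The sign in [g] turns this into the increasing form of [derive_nonneg_le]. *)
Lemma solution_unique_right f L x y t0 :
  lipschitz f L -> solves f x -> solves f y -> x t0 = y t0 ->
  forall t, t0 <= t -> x t = y t.
Proof.
  intros HL Hx Hy H0 t Ht.
  set (g := fun s => - ((x s - y s) ^ 2 * exp (- 2 * L * s))).
  assert (Hg : g t0 <= g t).
  { apply (derive_nonneg_le g (fun s =>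
      (2 * L * (x s - y s) ^ 2 - 2 * (x s - y s) * (f s (x s) - f s (y s)))
      * exp (- 2 * L * s))).
    - assumption.
    - intros s _. unfold g. assert (H1 := Hx s). assert (H2 := Hy s).
      auto_derive.
      + repeat split; eexists; eassumption.
      + replace_derive H1. replace_derive H2. ring.
    - intros s _. apply Rmult_le_pos; [|left; apply exp_pos].
      assert (HLs := HL s (x s) (y s)).
      assert (Rabs ((x s - y s) * (f s (x s) - f s (y s))) <= L * (x s - y s) ^ 2).
      { rewrite Rabs_mult, <- (pow2_abs (x s - y s)).
        assert (0 <= Rabs (x s - y s)) by apply Rabs_pos. nra. }
      assert (Hab := Rle_abs ((x s - y s) * (f s (x s) - f s (y s)))). lra. }
  unfold g in Hg. rewrite H0 in Hg.
  assert (He := exp_pos (- 2 * L * t)).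
  assert (Hsq := pow2_ge_0 (x t - y t)).
  assert ((x t - y t) ^ 2 = 0) by nra.
  assert (x t - y t = 0) by nra. lra.
Qed.

(** Time reversal, by which backward uniqueness follows from forward uniqueness. *)
Definition reverse (f : R -> R -> R) : R -> R -> R := fun t x => - f (- t) x.

Lemma solves_reverse f x : solves f x -> solves (reverse f) (fun t => x (- t)).
Proof.
  intros H t. unfold reverse.
  assert (H1 := H (- t)).
  auto_derive.
  - eexists; eassumption.
  - replace_derive H1. ring.
Qed.

Lemma lipschitz_reverse f L : lipschitz f L -> lipschitz (reverse f) L.
Proof.
  intros H t x y. unfold reverse.
  replace (- f (- t) x - - f (- t) y) with (- (f (- t) x - f (- t) y)) by ring.
  rewrite Rabs_Ropp. apply H.
Qed.

Lemma solution_unique f L x y t0 :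
  lipschitz f L -> solves f x -> solves f y -> x t0 = y t0 ->
  forall t, x t = y t.
Proof.
  intros HL Hx Hy H0 t.
  destruct (Rle_dec t0 t) as [Ht|Ht].
  - now apply (solution_unique_right f L x y t0).
  - rewrite <- (Ropp_involutive t).
    apply (solution_unique_right (reverse f) L (fun u => x (- u)) (fun u => y (- u)) (- t0)).
    + now apply lipschitz_reverse.
    + now apply solves_reverse.
    + now apply solves_reverse.
    + now rewrite Ropp_involutive.
    + lra.
Qed.

(** Orbits of a scalar equation cannot cross: a change of order gives a common point by the
    intermediate value theorem, hence equality everywhere. The times [t1] and [t2] may come in
    either order. *)
Lemma solution_monotone f L x y t1 t2 :
  lipschitz f L -> solves f x -> solves f y -> x t1 <= y t1 -> x t2 <= y t2.
Proof.
  intros HL Hx Hy H1. apply Rnot_lt_le; intros H2.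
  destruct H1 as [H1|H1];
    [|assert (x t2 = y t2) by (now apply (solution_unique f L x y t1)); lra].
  destruct (IVT_gen (fun t => x t - y t) t1 t2 0) as [s [_ Hs]].
  - intros t. apply continuity_pt_filterlim.
    apply (continuous_minus x y); now apply (solves_continuous f).
  - split; [rewrite Rmin_left | rewrite Rmax_right]; lra.
  - assert (x t1 = y t1); [|lra].
    apply (solution_unique f L x y s); [assumption..|lra].
Qed.

(** * Global existence by Picard iteration *)

Lemma exp_nondecreasing x y : x <= y -> exp x <= exp y.
Proof.
  intros [H|H]; [left; now apply exp_increasing | subst; apply Rle_refl].
Qed.

(** Integration reproduces the weight [exp (m |t - t0|)] with gain [1 / m]. This weighted estimate
    makes the Picard iteration contract on the whole line at once. *)
Lemma exp_growth_bound_right (g dg : R -> R) (k m t0 : R) :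
  0 < m -> 0 <= k -> (forall t, is_derive g t (dg t)) -> g t0 = 0 ->
  (forall t, Rabs (dg t) <= k * exp (m * Rabs (t - t0))) ->
  forall t, t0 <= t -> Rabs (g t) <= k / m * exp (m * Rabs (t - t0)).
Proof.
  intros Hm Hk Hd H0 Hb t Ht.
  assert (Hkm : 0 <= k / m) by (apply Rdiv_le_0_compat; lra).
  (* The two signs [e] give the two halves of the absolute value bound. *)
  assert (Hside : forall e, e = 1 \/ e = - 1 ->
    e * g t <= k / m * exp (m * Rabs (t - t0))).
  { intros e He.
    assert (H : k / m * exp (m * (t0 - t0)) - e * g t0
                <= k / m * exp (m * (t - t0)) - e * g t).
    { apply (derive_nonneg_le (fun s => k / m * exp (m * (s - t0)) - e * g s)
        (fun s => k * exp (m * (s - t0)) - e * dg s)); [assumption| |].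
      - intros s _. assert (H1 := Hd s). auto_derive.
        + eexists; eassumption.
        + replace_derive H1. unfold Rdiv, Rminus. field. lra.
      - intros s Hs. specialize (Hb s). rewrite (Rabs_pos_eq (s - t0)) in Hb by lra.
        assert (Hab := Rabs_le_between (dg s) (k * exp (m * (s - t0)))).
        apply Hab in Hb. destruct He; subst e; lra. }
    rewrite H0, Rminus_diag, Rmult_0_r, exp_0 in H.
    rewrite Rabs_pos_eq by lra. lra. }
  apply Rabs_le. assert (H1 := Hside 1 (or_introl eq_refl)).
  assert (H2 := Hside (-1) (or_intror eq_refl)). lra.
Qed.

Lemma exp_growth_bound (g dg : R -> R) (k m t0 : R) :
  0 < m -> 0 <= k -> (forall t, is_derive g t (dg t)) -> g t0 = 0 ->
  (forall t, Rabs (dg t) <= k * exp (m * Rabs (t - t0))) ->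
  forall t, Rabs (g t) <= k / m * exp (m * Rabs (t - t0)).
Proof.
  intros Hm Hk Hd H0 Hb t.
  destruct (Rle_dec t0 t) as [Ht|Ht].
  - now apply (exp_growth_bound_right g dg).
  - assert (Hflip : forall s, Rabs (- s - t0) = Rabs (s - - t0)).
    { intros s. rewrite <- Rabs_Ropp. f_equal. ring. }
    assert (H := exp_growth_bound_right (fun s => g (- s)) (fun s => - dg (- s)) k m (- t0)).
    specialize (H Hm Hk). rewrite <- (Ropp_involutive t), Hflip. apply H.
    + intros s. assert (H1 := Hd (- s)). auto_derive.
      * eexists; eassumption.
      * replace_derive H1. ring.
    + now rewrite Ropp_involutive.
    + intros s. rewrite Rabs_Ropp, <- Hflip. apply Hb.
    + lra.
Qed.

Lemma lipschitz_continuous (x : R -> R) (M : R) :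
  0 < M -> (forall s t, Rabs (x t - x s) <= M * Rabs (t - s)) ->
  forall t, continuous x t.
Proof.
  intros HM HL t. apply filterlim_locally. intros e.
  assert (He : 0 < e / M) by (apply Rdiv_lt_0_compat; [apply cond_pos|lra]).
  exists (mkposreal _ He). intros u Hu.
  change (Rabs (u - t) < e / M) in Hu. change (Rabs (x u - x t) < e).
  apply Rle_lt_trans with (M * Rabs (u - t)); [apply HL|].
  apply Rlt_le_trans with (M * (e / M)); [now apply Rmult_lt_compat_l|].
  right; field; lra.
Qed.

Lemma derive_bound_lipschitz (x dx : R -> R) (M : R) :
  (forall t, is_derive x t (dx t)) -> (forall t, Rabs (dx t) <= M) ->
  forall s t, Rabs (x t - x s) <= M * Rabs (t - s).
Proof.
  intros Hd Hb s t.
  destruct (MVT_gen x s t dx) as [c [_ Heq]].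
  - intros; apply Hd.
  - intros; apply continuity_pt_filterlim.
    apply (ex_derive_continuous x); eexists; apply Hd.
  - rewrite Heq, Rabs_mult. apply Rmult_le_compat_r; [apply Rabs_pos|apply Hb].
Qed.

(** Continuity of [f] in the form the iteration consumes: along continuous curves, so that each
    integrand is continuous. *)
Definition composable (f : R -> R -> R) : Prop :=
  forall x : R -> R, (forall t, continuous x t) ->
  forall t, continuous (fun s => f s (x s)) t.

Definition bounded_by (f : R -> R -> R) (M : R) : Prop := forall t x, Rabs (f t x) <= M.

Definition primitive_from (g : R -> R) (t0 x0 t : R) : R := x0 + RInt g t0 t.

Lemma is_derive_add_const (g : R -> R) (c t l : R) :
  is_derive g t l -> is_derive (fun u => c + g u) t l.
Proof.
  intros H. auto_derive; [eexists; eassumption|]. replace_derive H. ring.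
Qed.

Lemma primitive_from_derive (g : R -> R) (t0 x0 t : R) :
  (forall s, continuous g s) -> is_derive (primitive_from g t0 x0) t (g t).
Proof.
  intros Hg. apply is_derive_add_const.
  apply (is_derive_RInt g (RInt g t0) t0 t); [|apply Hg].
  apply filter_forall. intros u. apply (RInt_correct (V := R_CompleteNormedModule)).
  apply (ex_RInt_continuous (V := R_CompleteNormedModule)). intros; apply Hg.
Qed.

Lemma primitive_from_start (g : R -> R) (t0 x0 : R) : primitive_from g t0 x0 t0 = x0.
Proof.
  unfold primitive_from. rewrite RInt_point. apply Rplus_0_r.
Qed.

Fixpoint picard (f : R -> R -> R) (t0 x0 : R) (n : nat) : R -> R :=
  match n with
  | O => fun _ => x0
  | S n => primitive_from (fun s => f s (picard f t0 x0 n s)) t0 x0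
  end.

Lemma half_pow_small e : 0 < e -> exists n, (1 / 2) ^ n < e.
Proof.
  intros He. destruct (pow_lt_1_zero (1 / 2) ltac:(rewrite Rabs_pos_eq; lra) e He) as [N HN].
  exists N. specialize (HN N (le_n N)). rewrite Rabs_pos_eq in HN; [assumption|].
  left; apply pow_lt; lra.
Qed.

Lemma le_of_half_pow (u c : R) : 0 <= c -> (forall n, u <= c * (1 / 2) ^ n) -> u <= 0.
Proof.
  intros Hc H. apply Rnot_lt_le; intros Hu.
  destruct (half_pow_small (u / (c + 1))) as [n Hn]; [apply Rdiv_lt_0_compat; lra|].
  specialize (H n). apply (Rmult_lt_compat_l (c + 1)) in Hn; [|lra].
  replace ((c + 1) * (u / (c + 1))) with u in Hn by (field; lra).
  assert (0 < (1 / 2) ^ n) by (apply pow_lt; lra). lra.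
Qed.

Section Picard.
Variables (f : R -> R -> R) (L M t0 x0 : R).
Hypotheses (HL0 : 0 < L) (HM0 : 0 < M).
Hypotheses (Hcomp : composable f) (HL : lipschitz f L) (HM : bounded_by f M).

Let p := picard f t0 x0.
(** The exponent is twice the Lipschitz constant: applying [f] costs a factor [L], integrating the
    weight gains [1 / (2 L)], so every iteration halves the gap. *)
Let K t := M / L * exp (2 * L * Rabs (t - t0)).

Lemma picard_continuous n t : continuous (p n) t.
Proof.
  revert t. induction n as [|n IH]; intros t.
  - apply continuous_const.
  - apply (ex_derive_continuous (p (S n))). eexists.
    apply primitive_from_derive. intros s. now apply Hcomp.
Qed.

Lemma picard_derive n t : is_derive (p (S n)) t (f t (p n t)).
Proof.
  apply (primitive_from_derive (fun s => f s (p n s))). intros s.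
  apply Hcomp, picard_continuous.
Qed.

Lemma picard_start n : p n t0 = x0.
Proof. destruct n; [reflexivity|apply primitive_from_start]. Qed.

Lemma picard_gap n t : Rabs (p (S n) t - p n t) <= K t * (1 / 2) ^ n.
Proof.
  revert t. induction n as [|n IH]; intros t.
  - unfold K.
    assert (H : Rabs (p 1 t - p 0 t) <= M / (2 * L) * exp (2 * L * Rabs (t - t0))).
    { apply (exp_growth_bound (fun s => p 1 s - p 0 s) (fun s => f s (p 0 s))); try lra.
      - intros s. apply (is_derive_ext (fun u => - x0 + p 1 u)).
        + intros u. change (- x0 + p 1 u = p 1 u - x0). ring.
        + apply is_derive_add_const, picard_derive.
      - rewrite !picard_start. ring.
      - intros s. apply Rle_trans with (M * 1); [rewrite Rmult_1_r; apply HM|].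
        apply Rmult_le_compat_l; [lra|].
        rewrite <- exp_0. apply exp_nondecreasing. apply Rmult_le_pos; [lra|apply Rabs_pos]. }
    assert (0 < exp (2 * L * Rabs (t - t0))) by apply exp_pos.
    assert (0 < M / L) by (apply Rdiv_lt_0_compat; lra).
    replace (M / (2 * L)) with (M / L / 2) in H by (field; lra). simpl. nra.
  - unfold K.
    replace (M / L * exp (2 * L * Rabs (t - t0)) * (1 / 2) ^ S n)
      with (M * (1 / 2) ^ n / (2 * L) * exp (2 * L * Rabs (t - t0)))
      by (simpl; field; lra).
    assert (0 < (1 / 2) ^ n) by (apply pow_lt; lra).
    apply (exp_growth_bound (fun s => p (S (S n)) s - p (S n) s)
             (fun s => f s (p (S n) s) - f s (p n s))); try nra.
    + intros s. apply (is_derive_minus (p (S (S n))) (p (S n))); apply picard_derive.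
    + rewrite !picard_start. ring.
    + intros s. eapply Rle_trans; [apply HL|].
      specialize (IH s). unfold K in IH.
      apply Rle_trans with (L * (M / L * exp (2 * L * Rabs (s - t0)) * (1 / 2) ^ n)).
      * apply Rmult_le_compat_l; [lra|exact IH].
      * right; field; lra.
Qed.

Lemma picard_gaps n k t : Rabs (p (n + k)%nat t - p n t) <= 2 * K t * (1 / 2) ^ n.
Proof.
  assert (HK : 0 < K t).
  { apply Rmult_lt_0_compat; [apply Rdiv_lt_0_compat; lra|apply exp_pos]. }
  assert (Hn : 0 < (1 / 2) ^ n) by (apply pow_lt; lra).
  (* The induction carries the exact partial sum of the geometric series; the factor [1 - (1/2)^k]
     is dropped afterwards. *)
  assert (H : Rabs (p (n + k)%nat t - p n t) <= 2 * K t * (1 / 2) ^ n * (1 - (1 / 2) ^ k)).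
  { induction k as [|k IH].
    - rewrite Nat.add_0_r, Rminus_diag, Rabs_R0. simpl. lra.
    - rewrite Nat.add_succ_r.
      replace (p (S (n + k)) t - p n t)
        with ((p (S (n + k)) t - p (n + k)%nat t) + (p (n + k)%nat t - p n t)) by ring.
      eapply Rle_trans; [apply Rabs_triang|].
      assert (H := picard_gap (n + k) t). rewrite pow_add in H. simpl (_ ^ S k). lra. }
  assert (0 < (1 / 2) ^ k) by (apply pow_lt; lra).
  assert (0 < K t * (1 / 2) ^ n) by now apply Rmult_lt_0_compat. nra.
Qed.

(** An informative sigma type, so that the limits for all [t] can be collected into a function. *)
Lemma picard_limit t :
  { l | forall n, Rabs (l - p n t) <= 2 * K t * (1 / 2) ^ n }.
Proof.
  assert (HK : 0 < K t).
  { apply Rmult_lt_0_compat; [apply Rdiv_lt_0_compat; lra|apply exp_pos]. }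
  exists (real (Lim_seq (fun n => p n t))).
  assert (Hl : is_lim_seq (fun n => p n t) (real (Lim_seq (fun n => p n t)))).
  { cut (ex_finite_lim_seq (fun n => p n t)).
    { intros [l Hl]. now rewrite (is_lim_seq_unique _ _ Hl). }
    apply ex_lim_seq_cauchy_corr. intros e.
    destruct (half_pow_small (e / (4 * K t))) as [N HN];
      [apply Rdiv_lt_0_compat; [apply cond_pos|lra]|].
    exists N. intros n m Hn Hm.
    assert (Hn' := picard_gaps N (n - N) t). assert (Hm' := picard_gaps N (m - N) t).
    replace (N + (n - N))%nat with n in Hn' by lia.
    replace (N + (m - N))%nat with m in Hm' by lia.
    apply (Rmult_lt_compat_l (4 * K t)) in HN; [|lra].
    replace (4 * K t * (e / (4 * K t))) with (pos e) in HN by (field; lra).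
    apply Rabs_le_between in Hn', Hm'. apply Rabs_def1; lra. }
  intros n.
  assert (Hd : is_lim_seq (fun k => Rabs (p (n + k)%nat t - p n t))
                 (Rabs (Lim_seq (fun n => p n t) - p n t))).
  { apply (is_lim_seq_abs _ (Finite (Lim_seq (fun n => p n t) - p n t))).
    apply is_lim_seq_minus'; [|apply is_lim_seq_const].
    apply (is_lim_seq_incr_n (fun k => p k t) n) in Hl.
    apply (is_lim_seq_ext (fun k => p (k + n)%nat t)); [|exact Hl].
    intros k. now rewrite Nat.add_comm. }
  apply (is_lim_seq_le _ (fun _ => 2 * K t * (1 / 2) ^ n) _ (2 * K t * (1 / 2) ^ n)) in Hd.
  - exact Hd.
  - intros k. apply picard_gaps.
  - apply is_lim_seq_const.
Qed.

(** The limit [x] inherits the Lipschitz constant [M] of the iterates, hence is continuous and can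
    be put under the integral. The resulting [q] and [x] are both within a multiple of [(1/2)^n] of
    the iterate [p (S n)], so they coincide. *)
Lemma picard_solution : exists x, solves f x /\ x t0 = x0.
Proof.
  set (x := fun t => proj1_sig (picard_limit t)).
  assert (Hx : forall n t, Rabs (x t - p n t) <= 2 * K t * (1 / 2) ^ n)
    by (intros n t; apply (proj2_sig (picard_limit t))).
  assert (HK : forall t, 0 < K t).
  { intros t. apply Rmult_lt_0_compat; [apply Rdiv_lt_0_compat; lra|apply exp_pos]. }
  assert (Hxc : forall t, continuous x t).
  { apply (lipschitz_continuous x M HM0). intros s t.
    apply Rminus_le.
    apply (le_of_half_pow _ (K t + K s)); [assert (H1 := HK t); assert (H2 := HK s); lra|].
    intros n. assert (H1 := Hx (S n) t). assert (H2 := Hx (S n) s).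
    assert (H3 := derive_bound_lipschitz (p (S n)) (fun u => f u (p n u)) M
             (picard_derive n) ltac:(intros; apply HM) s t).
    replace (x t - x s) with
      ((x t - p (S n) t) - (x s - p (S n) s) + (p (S n) t - p (S n) s)) by ring.
    assert (H4 := Rabs_triang ((x t - p (S n) t) - (x s - p (S n) s)) (p (S n) t - p (S n) s)).
    assert (H5 := Rabs_triang (x t - p (S n) t) (- (x s - p (S n) s))).
    rewrite Rabs_Ropp in H5. unfold Rminus in *. simpl pow in *. lra. }
  set (q := primitive_from (fun s => f s (x s)) t0 x0).
  assert (Hq : forall t, is_derive q t (f t (x t))).
  { intros t. apply (primitive_from_derive (fun s => f s (x s))). now apply Hcomp. }
  assert (Hqx : forall t, q t = x t).
  { intros t. apply Rminus_diag_uniq.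
    assert (H : Rabs (q t - x t) <= 0).
    { apply (le_of_half_pow _ (2 * K t)); [assert (H := HK t); lra|]. intros n.
      assert (H1 : Rabs (q t - p (S n) t) <=
        2 * M * (1 / 2) ^ n / (2 * L) * exp (2 * L * Rabs (t - t0))).
      { assert (0 < (1 / 2) ^ n) by (apply pow_lt; lra).
        apply (exp_growth_bound (fun s => q s - p (S n) s)
                 (fun s => f s (x s) - f s (p n s))); try nra.
        - intros s. apply (is_derive_minus q (p (S n))); [apply Hq|apply picard_derive].
        - rewrite picard_start. unfold q. rewrite primitive_from_start. ring.
        - intros s. eapply Rle_trans; [apply HL|].
          apply Rle_trans with (L * (2 * K s * (1 / 2) ^ n)).
          + apply Rmult_le_compat_l; [lra|apply Hx].
          + right; unfold K; field; lra. }
      replace (2 * M * (1 / 2) ^ n / (2 * L) * exp (2 * L * Rabs (t - t0)))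
        with (K t * (1 / 2) ^ n) in H1 by (unfold K; field; lra).
      assert (H2 := Hx (S n) t). simpl pow in H2.
      replace (q t - x t) with ((q t - p (S n) t) + - (x t - p (S n) t)) by ring.
      eapply Rle_trans; [apply Rabs_triang|]. rewrite Rabs_Ropp. lra. }
    assert (H' := Rabs_pos (q t - x t)).
    apply Rabs_eq_0. lra. }
  exists x. split.
  - intros t. apply (is_derive_ext q); [exact Hqx|apply Hq].
  - rewrite <- Hqx. apply primitive_from_start.
Qed.
End Picard.

(** * Orbits emanating from a node at minus infinity *)

Lemma upper_barrier f x y dy T s :
  T <= s -> solves f x ->
  (forall t, T <= t <= s -> is_derive y t (dy t)) ->
  (forall t, T <= t <= s -> f t (y t) < dy t) ->
  x T <= y T -> x s <= y s.
Proof.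
  intros HTs Hx Hy Hf H0.
  assert (0 <= y s - x s); [|lra].
  apply (barrier (fun t => y t - x t) (fun t => dy t - f t (x t)) T s); try lra.
  - intros t Ht. apply (is_derive_minus y x); [now apply Hy|apply Hx].
  - intros t Ht Hd. replace (x t) with (y t) by lra. specialize (Hf t Ht). lra.
Qed.

Lemma upper_barrier_strict f x y dy T s :
  T < s -> solves f x ->
  (forall t, T <= t <= s -> is_derive y t (dy t)) ->
  (forall t, T <= t <= s -> f t (y t) < dy t) ->
  x T <= y T -> x s < y s.
Proof.
  intros HTs Hx Hy Hf H0.
  assert (0 < y s - x s); [|lra].
  apply (barrier_strict (fun t => y t - x t) (fun t => dy t - f t (x t)) T s); try lra.
  - intros t Ht. apply (is_derive_minus y x); [now apply Hy|apply Hx].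
  - intros t Ht Hd. replace (x t) with (y t) by lra. specialize (Hf t Ht). lra.
Qed.

Lemma upper_barrier_const f x c T s :
  T <= s -> solves f x -> (forall t, T <= t <= s -> f t c < 0) ->
  x T <= c -> x s <= c.
Proof.
  intros HTs Hx Hf.
  apply (upper_barrier f x (fun _ => c) (fun _ => 0)); try assumption.
  intros t _. apply is_derive_Reals, derivable_pt_lim_const.
Qed.

(** Conjugation by [x -> - x], which turns every statement about upper barriers into one about lower
    barriers. *)
Definition negate (f : R -> R -> R) : R -> R -> R := fun t x => - f t (- x).

Lemma solves_negate f x : solves f x -> solves (negate f) (fun t => - x t).
Proof.
  intros H t. unfold negate. rewrite Ropp_involutive.
  apply (is_derive_opp x), H.
Qed.

Lemma is_lim_negate (x : R -> R) (l : R) :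
  is_lim x m_infty l -> is_lim (fun t => - x t) m_infty (- l).
Proof. intros H. now apply (is_lim_opp x m_infty l). Qed.

(* [x0] is an asymptotic equilibrium at [-oo], exponentially attracting forward
   in time. *)
Definition node (f : R -> R -> R) (x0 : R) : Prop :=
  is_lim (fun t => f t x0) m_infty 0 /\
  exists T eta c, 0 < eta /\ 0 < c /\
    forall t x y, t <= T -> x0 - eta <= y -> y <= x -> x <= x0 + eta ->
      f t x - f t y <= - c * (x - y).

Lemma node_negate (f : R -> R -> R) (x0 : R) : node f x0 -> node (negate f) (- x0).
Proof.
  intros [Hl (T & eta & c & He & Hc & H)]. split.
  - unfold negate. rewrite Ropp_involutive, <- Ropp_0. now apply is_lim_negate.
  - exists T, eta, c. repeat split; try assumption.
    intros t x y Ht H1 H2 H3. unfold negate.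
    assert (Hf := H t (- y) (- x) Ht). lra.
Qed.

Definition left_orbit (f : R -> R -> R) (x0 : R) (x : R -> R) : Prop :=
  solves f x /\ is_lim x m_infty x0.

Lemma left_orbit_negate (f : R -> R -> R) (x0 : R) x :
  left_orbit f x0 x -> left_orbit (negate f) (- x0) (fun t => - x t).
Proof.
  intros [H1 H2]. split; [now apply solves_negate|now apply is_lim_negate].
Qed.

(** Above [x0 + e] the slope is at most [- c e / 2] in the far past. A solution above that level at
    [t1] was above it at all earlier times, since the level is a barrier; followed backwards it
    would climb out of the strip. *)
Lemma strip_limit_upper (f : R -> R -> R) (x0 : R) x T eta :
  node f x0 -> solves f x -> (forall t, t <= T -> x t <= x0 + eta) ->
  (exists T0 c, 0 < c /\ forall t u v, t <= T0 -> x0 - eta <= v -> v <= u ->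
     u <= x0 + eta -> f t u - f t v <= - c * (u - v)) ->
  forall e, 0 < e -> exists T', forall t, t <= T' -> x t <= x0 + e.
Proof.
  intros [Hl _] Hx Hstrip (T0 & c & Hc & Hdec) e He.
  destruct (Rle_dec eta e) as [Hee|Hee].
  { exists T. intros t Ht. specialize (Hstrip t Ht). lra. }
  rewrite is_lim_m_infty_iff in Hl.
  destruct (Hl (c * e / 2)) as [T1 HT1]; [nra|].
  set (T2 := Rmin T (Rmin T0 T1)).
  assert (H2a : T2 <= T) by apply Rmin_l.
  assert (H2b : T2 <= T0) by (eapply Rle_trans; [apply Rmin_r|apply Rmin_l]).
  assert (H2c : T2 <= T1) by (eapply Rle_trans; [apply Rmin_r|apply Rmin_r]).
  exists T2. intros t1 Ht1. apply Rnot_lt_le; intros Habove.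
  assert (Hf : forall t u, t <= t1 -> x0 + e <= u -> u <= x0 + eta -> f t u <= - (c * e / 2)).
  { intros t u Ht Hu1 Hu2.
    assert (H := Hdec t u x0 ltac:(lra) ltac:(lra) ltac:(lra) Hu2).
    assert (H' := HT1 t ltac:(lra)). apply Rabs_def2 in H'.
    assert (c * e <= c * (u - x0)) by (apply Rmult_le_compat_l; lra). lra. }
  assert (Hback : forall t, t <= t1 -> x0 + e < x t).
  { intros t Ht. apply Rnot_le_lt; intros Hle.
    assert (x t1 <= x0 + e); [|lra].
    apply (upper_barrier_const f x (x0 + e) t t1); try assumption.
    intros s Hs. assert (H := Hf s (x0 + e) ltac:(lra) ltac:(lra) ltac:(lra)). nra. }
  (* Over a backward time [h] the climb is at least [c e / 2 * h = 2 eta], more than the strip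
     allows. *)
  set (h := 4 * eta / (c * e)).
  assert (Hce : 0 < c * e) by nra.
  assert (Hh : 0 < h) by (apply Rdiv_lt_0_compat; lra).
  assert (H := derive_nonneg_le (fun t => - (c * e / 2) * t - x t)
                 (fun t => - (c * e / 2) - f t (x t)) (t1 - h) t1 ltac:(lra)).
  assert (H' := H ltac:(intros s _; assert (Hs := Hx s); auto_derive;
     [eexists; eassumption | replace_derive Hs; ring])); clear H.
  assert (H := H' ltac:(intros s Hs; assert (Hs1 := Hback s ltac:(lra));
    assert (Hs2 := Hf s (x s) ltac:(lra) ltac:(lra) ltac:(apply Hstrip; lra)); lra)).
  simpl in H.
  assert (Hlast := Hstrip (t1 - h) ltac:(lra)).
  assert (c * e / 2 * h = 2 * eta) by (unfold h; field; nra). lra.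
Qed.

(** A shooting argument. Both edges [x0 - eta] and [x0 + eta] point inward before [T1]. The orbit
    through the supremum of the values reached at [T1] from the lower edge stays in the strip for
    all past times, and contraction then forces the limit [x0]. *)
Lemma left_orbit_exists (f : R -> R -> R) (x0 : R) L M :
  0 < L -> 0 < M -> composable f -> lipschitz f L -> bounded_by f M -> node f x0 ->
  exists x, left_orbit f x0 x.
Proof.
  intros HL0 HM0 Hcomp HL HM Hnode.
  assert (Hnode' := Hnode). destruct Hnode' as [Hl (T & eta & c & He & Hc & Hdec)].
  assert (Hl' := Hl). rewrite is_lim_m_infty_iff in Hl'.
  (* Between the centre and an edge the contraction changes [f] by at least [c eta]; a value at the
     centre smaller than this leaves the signs on the edges intact. *)
  destruct (Hl' (c * eta)) as [T1' HT1']; [nra|].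
  set (T1 := Rmin T T1').
  assert (H1a : T1 <= T) by apply Rmin_l. assert (H1b : T1 <= T1') by apply Rmin_r.
  assert (Hup : forall t, t <= T1 -> f t (x0 + eta) < 0).
  { intros t Ht. assert (H := Hdec t (x0 + eta) x0 ltac:(lra) ltac:(lra) ltac:(lra) ltac:(lra)).
    assert (H' := HT1' t ltac:(lra)). apply Rabs_def2 in H'. lra. }
  assert (Hlow : forall t, t <= T1 -> 0 < f t (x0 - eta)).
  { intros t Ht. assert (H := Hdec t x0 (x0 - eta) ltac:(lra) ltac:(lra) ltac:(lra) ltac:(lra)).
    assert (H' := HT1' t ltac:(lra)). apply Rabs_def2 in H'. lra. }
  assert (Hflow : forall t0 v, exists x, solves f x /\ x t0 = v)
    by (intros; now apply (picard_solution f L M)).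
  assert (Htrap_up : forall x s t, solves f x -> s <= t -> t <= T1 ->
            x s <= x0 + eta -> x t <= x0 + eta).
  { intros x s t Hx Hst Ht. apply (upper_barrier_const f); try assumption.
    intros u Hu; apply Hup; lra. }
  assert (Htrap_low : forall x s t, solves f x -> s <= t -> t <= T1 ->
            x0 - eta <= x s -> x0 - eta <= x t).
  { intros x s t Hx Hst Ht H. cut (- x t <= - (x0 - eta)); [lra|].
    apply (upper_barrier_const (negate f) (fun u => - x u) _ s t Hst).
    - now apply solves_negate.
    - intros u Hu. unfold negate. rewrite Ropp_involutive.
      assert (H' := Hlow u ltac:(lra)). lra.
    - lra. }
  set (A := fun v => exists s x, s <= T1 /\ solves f x /\ x s = x0 - eta /\ x T1 = v).
  (* Every orbit started on the upper edge bounds [A] from above: at the later of the two starting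
     times both orbits lie in the right order, and order persists. *)
  assert (HA : forall s y, s <= T1 -> solves f y -> y s = x0 + eta ->
                 forall v, A v -> v <= y T1).
  { intros s y Hs Hy Hys v (s' & x & Hs' & Hx & Hxs & Hv). rewrite <- Hv.
    destruct (Rle_dec s' s) as [Hss|Hss].
    - apply (solution_monotone f L x y s T1 HL Hx Hy). rewrite Hys.
      apply (Htrap_up x s' s); try assumption; lra.
    - apply (solution_monotone f L x y s' T1 HL Hx Hy). rewrite Hxs.
      apply (Htrap_low y s s'); try assumption; lra. }
  destruct (completeness A) as [a [Hub Hlub]].
  { destruct (Hflow T1 (x0 + eta)) as [y [Hy Hy1]].
    exists (x0 + eta). intros v Hv. rewrite <- Hy1.
    apply (HA T1 y); try assumption; lra. }
  { destruct (Hflow T1 (x0 - eta)) as [x [Hx Hx1]].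
    exists (x0 - eta), T1, x. split; [lra|now split]. }
  destruct (Hflow T1 a) as [X [HX HXa]].
  assert (HXlow : forall s, s <= T1 -> x0 - eta <= X s).
  { intros s Hs. destruct (Hflow s (x0 - eta)) as [x [Hx Hxs]]. rewrite <- Hxs.
    apply (solution_monotone f L x X T1 s HL Hx HX). rewrite HXa. apply Hub.
    exists s, x. now split. }
  assert (HXup : forall s, s <= T1 -> X s <= x0 + eta).
  { intros s Hs. destruct (Hflow s (x0 + eta)) as [y [Hy Hys]]. rewrite <- Hys.
    apply (solution_monotone f L X y T1 s HL HX Hy). rewrite HXa. apply Hlub.
    intros v Hv. now apply (HA s y). }
  exists X. split; [assumption|]. apply is_lim_m_infty_iff. intros e Hepos.
  destruct (strip_limit_upper f x0 X T1 eta Hnode HX HXup) with (e := e / 2)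
    as [Ta HTa]; [exists T, c; split; assumption|lra|].
  destruct (strip_limit_upper (negate f) (- x0) (fun t => - X t) T1 eta
     (node_negate _ _ Hnode) (solves_negate _ _ HX)) with (e := e / 2) as [Tb HTb].
  - intros t Ht. specialize (HXlow t Ht). lra.
  - exists T, c. split; [assumption|]. intros t u v Ht H1 H2 H3. unfold negate.
    assert (H := Hdec t (- v) (- u) Ht). lra.
  - lra.
  - exists (Rmin Ta Tb). intros t Ht.
    assert (H1 := HTa t ltac:(eapply Rle_trans; [exact Ht|apply Rmin_l])).
    assert (H2 := HTb t ltac:(eapply Rle_trans; [exact Ht|apply Rmin_r])).
    apply Rabs_def1; lra.
Qed.

(** Near the node [f] decreases in its second argument, so [y + e] is still a strict supersolution
    and lies above [x] far enough in the past. Letting [e] tend to [0] gives [x <= y] at [T2], and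
    the strict barrier carries this to [t1]. *)
Lemma left_orbit_upper (f : R -> R -> R) (x0 : R) x y dy t1 :
  node f x0 -> left_orbit f x0 x -> is_lim y m_infty x0 ->
  (forall t, t <= t1 -> is_derive y t (dy t)) ->
  (forall t, t <= t1 -> f t (y t) < dy t) -> x t1 < y t1.
Proof.
  intros [_ (T & eta & c & He & Hc & Hdec)] [Hx Hxl] Hyl Hy Hf.
  rewrite is_lim_m_infty_iff in Hxl, Hyl.
  destruct (Hyl (eta / 2)) as [Ta HTa]; [lra|].
  (* [t1 - 1] guarantees [T2 < t1], as the strict barrier requires. *)
  set (T2 := Rmin T (Rmin Ta (t1 - 1))).
  assert (H2a : T2 <= T) by apply Rmin_l.
  assert (H2b : T2 <= Ta) by (eapply Rle_trans; [apply Rmin_r|apply Rmin_l]).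
  assert (H2c : T2 <= t1 - 1) by (eapply Rle_trans; [apply Rmin_r|apply Rmin_r]).
  assert (Hle : forall e, 0 < e < eta / 2 -> x T2 <= y T2 + e).
  { intros e Hepos.
    destruct (Hxl (e / 2)) as [T3 HT3]; [lra|]. destruct (Hyl (e / 2)) as [T4 HT4]; [lra|].
    set (S := Rmin T2 (Rmin T3 T4)).
    assert (HSa : S <= T2) by apply Rmin_l.
    assert (HSb : S <= T3) by (eapply Rle_trans; [apply Rmin_r|apply Rmin_l]).
    assert (HSc : S <= T4) by (eapply Rle_trans; [apply Rmin_r|apply Rmin_r]).
    apply (upper_barrier f x (fun t => y t + e) dy S T2 HSa Hx).
    - intros t Ht. apply (is_derive_ext (fun u => e + y u)).
      + intros u. apply Rplus_comm.
      + apply is_derive_add_const, Hy. lra.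
    - intros t Ht. assert (H := HTa t ltac:(lra)). apply Rabs_def2 in H.
      assert (H1 := Hdec t (y t + e) (y t) ltac:(lra) ltac:(lra) ltac:(lra) ltac:(lra)).
      assert (H2 := Hf t ltac:(lra)). nra.
    - assert (H3 := HT3 S HSb). assert (H4 := HT4 S HSc).
      apply Rabs_def2 in H3, H4. lra. }
  apply (upper_barrier_strict f x y dy T2 t1); try lra; try assumption.
  - intros t Ht; apply Hy; lra.
  - intros t Ht; apply Hf; lra.
  - apply Rnot_lt_le; intros Hlt.
    set (e := Rmin (eta / 4) ((x T2 - y T2) / 2)).
    assert (0 < e) by (apply Rmin_pos; lra).
    assert (e <= eta / 4) by apply Rmin_l.
    assert (e <= (x T2 - y T2) / 2) by apply Rmin_r.
    specialize (Hle e ltac:(lra)). lra.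
Qed.

Lemma left_orbit_lower (f : R -> R -> R) (x0 : R) x y dy t1 :
  node f x0 -> left_orbit f x0 x -> is_lim y m_infty x0 ->
  (forall t, t <= t1 -> is_derive y t (dy t)) ->
  (forall t, t <= t1 -> dy t < f t (y t)) -> y t1 < x t1.
Proof.
  intros Hn Hx Hyl Hy Hf. cut (- x t1 < - y t1); [lra|].
  apply (left_orbit_upper (negate f) (- x0) (fun t => - x t) (fun t => - y t)
           (fun t => - dy t)).
  - now apply node_negate.
  - now apply left_orbit_negate.
  - now apply is_lim_negate.
  - intros t Ht. now apply (is_derive_opp y), Hy.
  - intros t Ht. unfold negate. rewrite Ropp_involutive. specialize (Hf t Ht). lra.
Qed.

(** * Continuous dependence of emanating orbits on the equation and on the equilibrium *)

(** On the infinite past up to [T1] the contraction [- c k] beats a perturbation of size [delta], so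
    [x + k] bounds the perturbed orbit. On the finite interval from [T1] to [t1] the gap grows at
    most exponentially, by the factor [G]. *)
Lemma left_orbit_close_upper (f : R -> R -> R) (x0 : R) x L t1 e :
  node f x0 -> left_orbit f x0 x -> 0 < L -> lipschitz f L -> 0 < e ->
  exists delta, 0 < delta /\ forall g y0 y,
    (forall t u, Rabs (g t u - f t u) <= delta) -> Rabs (y0 - x0) <= delta ->
    left_orbit g y0 y -> y t1 <= x t1 + e.
Proof.
  intros [_ (T & eta & c & He & Hc & Hdec)] [Hx Hxl] HL0 HL Hepos.
  rewrite is_lim_m_infty_iff in Hxl.
  destruct (Hxl (eta / 2)) as [Ta HTa]; [lra|].
  set (T1 := Rmin T (Rmin Ta t1)).
  assert (H1a : T1 <= T) by apply Rmin_l.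
  assert (H1b : T1 <= Ta) by (eapply Rle_trans; [apply Rmin_r|apply Rmin_l]).
  assert (H1c : T1 <= t1) by (eapply Rle_trans; [apply Rmin_r|apply Rmin_r]).
  set (G := exp ((L + 1) * (t1 - T1))).
  assert (HG : 0 < G) by apply exp_pos.
  set (k := Rmin (eta / 4) (e / G)).
  assert (Hk : 0 < k) by (apply Rmin_pos; [lra|now apply Rdiv_lt_0_compat]).
  assert (Hk1 : k <= eta / 4) by apply Rmin_l.
  assert (Hk2 : k <= e / G) by apply Rmin_r.
  assert (Hkc : 0 < c * k) by nra.
  (* [delta <= k / 2] pays for the displaced equilibrium at the start, [delta <= c k / 2] for the
     perturbed slope. *)
  set (delta := Rmin k (c * k) / 2).
  assert (Hd : 0 < delta) by (unfold delta; assert (0 < Rmin k (c * k)) by (now apply Rmin_pos); lra).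
  assert (Hd1 : delta <= k / 2) by (unfold delta; assert (H := Rmin_l k (c * k)); lra).
  assert (Hd2 : delta <= c * k / 2) by (unfold delta; assert (H := Rmin_r k (c * k)); lra).
  exists delta. split; [assumption|]. intros g y0 y Hgf Hy0 [Hy Hyl].
  assert (HT1 : y T1 <= x T1 + k).
  { rewrite is_lim_m_infty_iff in Hyl.
    destruct (Hxl (k / 4)) as [T3 HT3]; [lra|]. destruct (Hyl (k / 4)) as [T4 HT4]; [lra|].
    set (S := Rmin T1 (Rmin T3 T4)).
    assert (HSa : S <= T1) by apply Rmin_l.
    assert (HSb : S <= T3) by (eapply Rle_trans; [apply Rmin_r|apply Rmin_l]).
    assert (HSc : S <= T4) by (eapply Rle_trans; [apply Rmin_r|apply Rmin_r]).
    apply (upper_barrier g y (fun t => x t + k) (fun t => f t (x t)) S T1 HSa Hy).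
    - intros t Ht. apply (is_derive_ext (fun u => k + x u)).
      + intros u. apply Rplus_comm.
      + apply is_derive_add_const, Hx.
    - intros t Ht. assert (H := HTa t ltac:(lra)). apply Rabs_def2 in H.
      assert (H1 := Hdec t (x t + k) (x t) ltac:(lra) ltac:(lra) ltac:(lra) ltac:(lra)).
      assert (H2 := Hgf t (x t + k)). apply Rabs_le_between in H2. lra.
    - assert (H3 := HT3 S HSb). assert (H4 := HT4 S HSc).
      apply Rabs_le_between in Hy0. apply Rabs_def2 in H3, H4. lra. }
  (* The rate is [L + 1]: [L] covers the Lipschitz growth and the surplus, at least [k], absorbs
     [delta]. *)
  assert (H : y t1 <= x t1 + k * G).
  { apply (upper_barrier g y (fun t => x t + k * exp ((L + 1) * (t - T1)))
      (fun t => f t (x t) + (L + 1) * (k * exp ((L + 1) * (t - T1)))) T1 t1 H1c Hy).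
    - intros t _. assert (H1 := Hx t). auto_derive.
      + eexists; eassumption.
      + replace_derive H1. unfold Rminus. ring.
    - intros t Ht.
      assert (HE : 1 <= exp ((L + 1) * (t - T1))).
      { rewrite <- exp_0 at 1. apply exp_nondecreasing, Rmult_le_pos; lra. }
      set (E := exp ((L + 1) * (t - T1))) in *.
      assert (HkE : k * 1 <= k * E) by (apply Rmult_le_compat_l; lra).
      assert (H2 := Hgf t (x t + k * E)). apply Rabs_le_between in H2.
      assert (H3 := HL t (x t + k * E) (x t)).
      replace (x t + k * E - x t) with (k * E) in H3 by ring.
      rewrite (Rabs_pos_eq (k * E)) in H3 by lra. apply Rabs_le_between in H3. lra.
    - rewrite Rminus_diag, Rmult_0_r, exp_0. lra. }
  assert (k * G <= e).
  { replace e with (e / G * G) by (field; lra). apply Rmult_le_compat_r; lra. }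
  lra.
Qed.

Lemma lipschitz_negate f L : lipschitz f L -> lipschitz (negate f) L.
Proof.
  intros H t x y. unfold negate.
  replace (- f t (- x) - - f t (- y)) with (- (f t (- x) - f t (- y))) by ring.
  rewrite Rabs_Ropp, <- (Rabs_Ropp (x - y)).
  replace (- (x - y)) with (- x - - y) by ring. apply H.
Qed.

Lemma left_orbit_close (f : R -> R -> R) (x0 : R) x L t1 e :
  node f x0 -> left_orbit f x0 x -> 0 < L -> lipschitz f L -> 0 < e ->
  exists delta, 0 < delta /\ forall g y0 y,
    (forall t u, Rabs (g t u - f t u) <= delta) -> Rabs (y0 - x0) <= delta ->
    left_orbit g y0 y -> Rabs (y t1 - x t1) <= e.
Proof.
  intros Hn Hx HL0 HL He.
  destruct (left_orbit_close_upper f x0 x L t1 e Hn Hx HL0 HL He) as [da [Hda Ha]].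
  destruct (left_orbit_close_upper (negate f) (- x0) (fun t => - x t) L t1 e
     (node_negate _ _ Hn) (left_orbit_negate _ _ _ Hx) HL0 (lipschitz_negate _ _ HL) He)
    as [db [Hdb Hb]].
  exists (Rmin da db). split; [now apply Rmin_pos|].
  intros g y0 y Hg Hy0 Hy.
  assert (Hma := Rmin_l da db). assert (Hmb := Rmin_r da db).
  assert (H1 := Ha g y0 y ltac:(intros; eapply Rle_trans; [apply Hg|assumption])
                  ltac:(lra) Hy).
  assert (H2 := Hb (negate g) (- y0) (fun t => - y t)).
  cut (- y t1 <= - x t1 + e); [intros; apply Rabs_le; lra|].
  apply H2.
  - intros t u. unfold negate.
    replace (- g t (- u) - - f t (- u)) with (- (g t (- u) - f t (- u))) by ring.
    rewrite Rabs_Ropp. eapply Rle_trans; [apply Hg|assumption].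
  - replace (- y0 - - x0) with (- (y0 - x0)) by ring. rewrite Rabs_Ropp. lra.
  - now apply left_orbit_negate.
Qed.

(** * Trigonometric right-hand sides *)

Lemma Rabs_cos_le_1 x : Rabs (cos x) <= 1.
Proof. apply Rabs_le, COS_bound. Qed.

Lemma Rabs_sin_le_1 x : Rabs (sin x) <= 1.
Proof. apply Rabs_le, SIN_bound. Qed.

Lemma sin_lipschitz x y : Rabs (sin x - sin y) <= Rabs (x - y).
Proof.
  rewrite <- (Rmult_1_l (Rabs (x - y))).
  apply (derive_bound_lipschitz sin cos).
  - intros t. apply is_derive_Reals, derivable_pt_lim_sin.
  - apply Rabs_cos_le_1.
Qed.

Lemma cos_lipschitz x y : Rabs (cos x - cos y) <= Rabs (x - y).
Proof.
  rewrite <- (Rmult_1_l (Rabs (x - y))).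
  apply (derive_bound_lipschitz cos (fun t => - sin t)).
  - intros t. apply is_derive_Reals, derivable_pt_lim_cos.
  - intros t. rewrite Rabs_Ropp. apply Rabs_sin_le_1.
Qed.

Definition trig_form (f : R -> R -> R) (A B C : R -> R) : Prop :=
  forall t x, f t x = A t * cos x + B t * sin x + C t.

Lemma Rabs_mult_le x y X Y : Rabs x <= X -> Rabs y <= Y -> Rabs (x * y) <= X * Y.
Proof.
  intros. rewrite Rabs_mult. apply Rmult_le_compat; try apply Rabs_pos; assumption.
Qed.

Lemma trig_lipschitz f A B C K :
  trig_form f A B C -> (forall t, Rabs (A t) <= K) -> (forall t, Rabs (B t) <= K) ->
  lipschitz f (2 * K).
Proof.
  intros Hf HA HB t x y. rewrite !Hf.
  replace (A t * cos x + B t * sin x + C t - (A t * cos y + B t * sin y + C t))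
    with (A t * (cos x - cos y) + B t * (sin x - sin y)) by ring.
  eapply Rle_trans; [apply Rabs_triang|].
  assert (H1 := Rabs_mult_le _ _ _ _ (HA t) (cos_lipschitz x y)).
  assert (H2 := Rabs_mult_le _ _ _ _ (HB t) (sin_lipschitz x y)). lra.
Qed.

Lemma trig_bounded f A B C K :
  trig_form f A B C -> (forall t, Rabs (A t) <= K) -> (forall t, Rabs (B t) <= K) ->
  (forall t, Rabs (C t) <= K) -> bounded_by f (3 * K).
Proof.
  intros Hf HA HB HC t x. rewrite Hf.
  assert (H1 := Rabs_mult_le _ _ _ _ (HA t) (Rabs_cos_le_1 x)).
  assert (H2 := Rabs_mult_le _ _ _ _ (HB t) (Rabs_sin_le_1 x)).
  specialize (HC t). rewrite Rmult_1_r in H1, H2.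
  apply Rabs_le_between in H1, H2, HC. apply Rabs_le. lra.
Qed.

Lemma trig_composable f A B C :
  trig_form f A B C -> (forall t, continuous A t) -> (forall t, continuous B t) ->
  (forall t, continuous C t) -> composable f.
Proof.
  intros Hf HA HB HC x Hx t.
  apply (continuous_ext (fun s => A s * cos (x s) + B s * sin (x s) + C s)).
  { intros s. symmetry. apply Hf. }
  apply (continuous_plus (fun s => A s * cos (x s) + B s * sin (x s)) C); [|apply HC].
  apply (continuous_plus (fun s => A s * cos (x s)) (fun s => B s * sin (x s))).
  - apply (continuous_mult A (fun s => cos (x s))); [apply HA|].
    apply (continuous_comp x cos); [apply Hx|apply continuous_cos].
  - apply (continuous_mult B (fun s => sin (x s))); [apply HB|].
    apply (continuous_comp x sin); [apply Hx|apply continuous_sin].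
Qed.

(** The two conditions say that [x0] is an equilibrium of the limit equation with negative
    linearization [B0 cos x0 - A0 sin x0 = - m]. By the mean value theorem the contraction survives
    near [x0] and near [-oo] with constant [m / 2]. *)
Lemma trig_node f A B C (A0 B0 C0 x0 : R) :
  trig_form f A B C ->
  is_lim A m_infty A0 -> is_lim B m_infty B0 -> is_lim C m_infty C0 ->
  A0 * cos x0 + B0 * sin x0 + C0 = 0 -> B0 * cos x0 < A0 * sin x0 -> node f x0.
Proof.
  intros Hf HA HB HC H0 Hneg.
  rewrite is_lim_m_infty_iff in HA, HB, HC.
  assert (Hc1 := Rabs_cos_le_1). assert (Hs1 := Rabs_sin_le_1).
  split.
  - apply is_lim_m_infty_iff. intros e He.
    destruct (HA (e / 3)) as [Ta HTa]; [lra|]. destruct (HB (e / 3)) as [Tb HTb]; [lra|].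
    destruct (HC (e / 3)) as [Tc HTc]; [lra|].
    exists (Rmin Ta (Rmin Tb Tc)). intros t Ht.
    assert (H2 := Rle_trans _ _ _ Ht (Rmin_l _ _)).
    assert (H3 := Rle_trans _ _ _ (Rle_trans _ _ _ Ht (Rmin_r _ _)) (Rmin_l _ _)).
    assert (H4 := Rle_trans _ _ _ (Rle_trans _ _ _ Ht (Rmin_r _ _)) (Rmin_r _ _)).
    specialize (HTa t H2). specialize (HTb t H3). specialize (HTc t H4).
    rewrite Hf.
    replace (A t * cos x0 + B t * sin x0 + C t - 0) with
      ((A t - A0) * cos x0 + (B t - B0) * sin x0 + (C t - C0)) by lra.
    assert (H5 := Rabs_mult_le _ _ _ _ (Rle_refl (Rabs (A t - A0))) (Hc1 x0)).
    assert (H6 := Rabs_mult_le _ _ _ _ (Rle_refl (Rabs (B t - B0))) (Hs1 x0)).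
    eapply Rle_lt_trans; [apply Rabs_triang|].
    eapply Rle_lt_trans; [apply Rplus_le_compat_r, Rabs_triang|]. lra.
  - set (m := A0 * sin x0 - B0 * cos x0). assert (Hm : 0 < m) by (unfold m; lra).
    set (S := Rabs A0 + Rabs B0).
    assert (HS : 0 <= S) by (unfold S; assert (H1 := Rabs_pos A0); assert (H2 := Rabs_pos B0); lra).
    (* The loss [m / 2] splits into [m / 4] for moving [x0] by [eta] and twice [m / 8] for replacing
       [A0], [B0] by [A t], [B t]. The [+ 1] keeps the denominator positive. *)
    set (eta := m / (4 * (S + 1))).
    assert (Heta : 0 < eta) by (apply Rdiv_lt_0_compat; lra).
    assert (HSeta : S * eta <= m / 4).
    { replace (m / 4) with ((S + 1) * eta) by (unfold eta; field; lra).
      apply Rmult_le_compat_r; lra. }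
    destruct (HA (m / 8)) as [Ta HTa]; [lra|]. destruct (HB (m / 8)) as [Tb HTb]; [lra|].
    exists (Rmin Ta Tb), eta, (m / 2). repeat split; try lra.
    intros t x y Ht Hy Hyx Hx.
    specialize (HTa t (Rle_trans _ _ _ Ht (Rmin_l _ _))).
    specialize (HTb t (Rle_trans _ _ _ Ht (Rmin_r _ _))).
    destruct (MVT_gen (fun u => A t * cos u + B t * sin u + C t) y x
      (fun u => - A t * sin u + B t * cos u)) as [z [Hz Heq]].
    + intros u _. auto_derive; [trivial|ring].
    + intros u _. apply continuity_pt_filterlim.
      apply (ex_derive_continuous (fun u => A t * cos u + B t * sin u + C t)).
      auto_derive. trivial.
    + rewrite Rmin_left, Rmax_right in Hz by lra. rewrite !Hf, Heq.
      apply Rmult_le_compat_r; [lra|].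
      assert (Hzx : Rabs (z - x0) <= eta) by (apply Rabs_le; lra).
      assert (H1 := Rabs_mult_le _ _ _ _ (Rlt_le _ _ HTa) (Hs1 z)).
      assert (H2 := Rabs_mult_le _ _ _ _ (Rlt_le _ _ HTb) (Hc1 z)).
      assert (H3 := Rabs_mult_le _ _ _ _ (Rle_refl (Rabs A0))
                      (Rle_trans _ _ _ (sin_lipschitz z x0) Hzx)).
      assert (H4 := Rabs_mult_le _ _ _ _ (Rle_refl (Rabs B0))
                      (Rle_trans _ _ _ (cos_lipschitz z x0) Hzx)).
      unfold S in HSeta. apply Rabs_le_between in H1, H2, H3, H4. unfold m in *. lra.
Qed.

Lemma is_lim_comp_continuous_m_infty (phi x : R -> R) (l : R) :
  is_lim x m_infty l -> continuous phi l -> is_lim (fun t => phi (x t)) m_infty (phi l).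
Proof.
  intros Hx Hphi.
  apply (filterlim_comp R R R x phi (Rbar_locally' m_infty) (locally l)); assumption.
Qed.

(** * Explicit orbits of the first coordinates *)

(** The solution of [theta' = sin theta] through [PI / 2] at time [0]; with this normalization time
    reversal becomes [theta -> PI - theta]. *)
Definition theta_t (t : R) : R := 2 * atan (exp t).

Lemma theta_t_derive t : is_derive theta_t t (sin (theta_t t)).
Proof.
  unfold theta_t.
  replace (sin (2 * atan (exp t))) with (2 * (exp t / (1 + (exp t)²))).
  - auto_derive; [trivial|]. unfold Rsqr. assert (He := exp_pos t). field. nra.
  - rewrite sin_2a, sin_atan, cos_atan.
    assert (H : 0 < 1 + (exp t)²) by (assert (H := Rle_0_sqr (exp t)); lra).
    assert (Hs := sqrt_lt_R0 _ H). assert (Hq := sqrt_sqrt _ (Rlt_le _ _ H)).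
    rewrite <- Hq at 1. field. lra.
Qed.

Lemma theta_t_bounds t : 0 < theta_t t < PI.
Proof.
  unfold theta_t. assert (H := atan_bound (exp t)).
  assert (H1 := atan_increasing 0 (exp t) (exp_pos t)). rewrite atan_0 in H1. lra.
Qed.

Lemma theta_t_opp t : theta_t (- t) = PI - theta_t t.
Proof.
  unfold theta_t. rewrite exp_Ropp, atan_inv by apply exp_pos. lra.
Qed.

Lemma theta_t_0 : theta_t 0 = PI / 2.
Proof. unfold theta_t. rewrite exp_0, atan_1. lra. Qed.

Lemma theta_t_left : is_lim theta_t m_infty 0.
Proof.
  replace 0 with (2 * atan 0) by (rewrite atan_0; ring).
  apply (is_lim_comp_continuous_m_infty (fun u => 2 * atan u) exp 0 is_lim_exp_m).
  apply (ex_derive_continuous (fun u => 2 * atan u)). auto_derive. trivial.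
Qed.

Lemma is_lim_p_infty_reverse (x y : R -> R) (c l : R) :
  (forall t, x t = c - y (- t)) -> is_lim y m_infty l -> is_lim x p_infty (c - l).
Proof.
  intros Hxy Hy. rewrite is_lim_m_infty_iff in Hy. apply is_lim_spec. intros e.
  destruct (Hy e (cond_pos e)) as [T HT]. exists (- T). intros t Ht.
  rewrite Hxy. replace (c - y (- t) - (c - l)) with (- (y (- t) - l)) by ring.
  rewrite Rabs_Ropp. apply HT. lra.
Qed.

Lemma theta_t_right : is_lim theta_t p_infty PI.
Proof.
  replace (Finite PI) with (Finite (PI - 0)) by (f_equal; ring).
  apply (is_lim_p_infty_reverse _ theta_t); [|apply theta_t_left].
  intros t. rewrite theta_t_opp. ring.
Qed.

Lemma atan_derive t : is_derive atan t ((cos (atan t)) ^ 2).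
Proof.
  rewrite cos_atan.
  replace ((1 / sqrt (1 + t²)) ^ 2) with (/ (1 + t ^ 2)).
  - auto_derive; [trivial|]. simpl. ring.
  - assert (H : 0 < 1 + t²) by (assert (H := Rle_0_sqr t); lra).
    assert (Hs := sqrt_lt_R0 _ H). assert (Hq := sqrt_sqrt _ (Rlt_le _ _ H)).
    replace (1 + t ^ 2) with (sqrt (1 + t²) * sqrt (1 + t²)) by (rewrite Hq; unfold Rsqr; ring).
    field. lra.
Qed.

(** For [t < 0] one has [atan t + PI / 2 = atan (- 1 / t) <= - 1 / t]. *)
Lemma atan_left : is_lim atan m_infty (- (PI / 2)).
Proof.
  apply is_lim_m_infty_iff. intros e He.
  exists (- (2 / e)). intros t Ht.
  assert (H2e : 0 < 2 / e) by (apply Rdiv_lt_0_compat; lra).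
  assert (Hb := atan_bound t).
  assert (Hinv := atan_inv (- t) ltac:(lra)). rewrite atan_opp in Hinv.
  assert (Hlt : atan (/ - t) <= / - t).
  { assert (H := derive_bound_lipschitz atan (fun u => / (1 + u ^ 2)) 1).
    assert (Hpos : 0 < / - t) by (apply Rinv_0_lt_compat; lra).
    assert (H' := H ltac:(intros u; auto_derive; [trivial|simpl; ring])).
    assert (H'' := H' ltac:(intros u; assert (Hu := pow2_ge_0 u);
      rewrite Rabs_pos_eq by (left; apply Rinv_0_lt_compat; lra);
      rewrite <- Rinv_1; apply Rinv_le_contravar; lra) 0 (/ - t)).
    rewrite atan_0, !Rminus_0_r, (Rabs_pos_eq (/ - t)) in H'' by lra.
    apply Rabs_le_between in H''. lra. }
  assert (/ - t <= e / 2).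
  { replace (e / 2) with (/ (2 / e)) by (field; lra). apply Rinv_le_contravar; lra. }
  rewrite Rabs_pos_eq; lra.
Qed.

Lemma atan_right : is_lim atan p_infty (PI / 2).
Proof.
  replace (Finite (PI / 2)) with (Finite (0 - - (PI / 2))) by (f_equal; ring).
  apply (is_lim_p_infty_reverse _ atan); [|apply atan_left].
  intros t. rewrite atan_opp. ring.
Qed.

(** * The Theta- and Omega-flows *)

Definition Theta_flow (a E lam t x : R) : R := Theta_rhs a E lam (theta_t t) x.
Definition Omega_flow (a E lam gam t x : R) : R := Omega_rhs a E lam gam (atan t) x.

Lemma Theta_flow_trig a E lam :
  trig_form (Theta_flow a E lam)
    (fun t => - 2 * a * (sin (theta_t t) * cos (theta_t t)))
    (fun t => 2 * a * E * (sin (theta_t t)) ^ 2 - 1)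
    (fun t => 2 * lam * sin (theta_t t)).
Proof. intros t x. unfold Theta_flow, Theta_rhs. ring. Qed.

Lemma Omega_flow_trig a E lam gam :
  trig_form (Omega_flow a E lam gam)
    (fun t => 2 * a * sin (atan t)) (fun t => 2 * lam * cos (atan t))
    (fun t => 2 * gam * (sin (atan t) * cos (atan t)) + (cos (atan t)) ^ 2 - 2 * a * E).
Proof. intros t x. unfold Omega_flow, Omega_rhs. ring. Qed.

Lemma Rabs_plus_le x y X Y : Rabs x <= X -> Rabs y <= Y -> Rabs (x + y) <= X + Y.
Proof. intros. eapply Rle_trans; [apply Rabs_triang|lra]. Qed.

Lemma theta_t_continuous t : continuous theta_t t.
Proof. apply (ex_derive_continuous theta_t). eexists. apply theta_t_derive. Qed.

Lemma atan_continuous t : continuous atan t.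
Proof. apply (ex_derive_continuous atan). eexists. apply atan_derive. Qed.

Lemma Theta_flow_bounds a E lam :
  exists L M, 0 < L /\ 0 < M /\
    lipschitz (Theta_flow a E lam) L /\ bounded_by (Theta_flow a E lam) M.
Proof.
  set (K := Rabs (2 * a) + Rabs (2 * a * E) + Rabs (2 * lam) + 1).
  assert (H1 := Rabs_pos (2 * a)). assert (H2 := Rabs_pos (2 * a * E)).
  assert (H3 := Rabs_pos (2 * lam)).
  assert (HA : forall t, Rabs (- 2 * a * (sin (theta_t t) * cos (theta_t t))) <= K).
  { intros t. apply Rle_trans with (Rabs (2 * a) * (1 * 1)); [|unfold K; lra].
    apply Rabs_mult_le.
    - replace (- 2 * a) with (- (2 * a)) by ring. rewrite Rabs_Ropp. lra.
    - apply Rabs_mult_le; [apply Rabs_sin_le_1|apply Rabs_cos_le_1]. }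
  assert (HB : forall t, Rabs (2 * a * E * (sin (theta_t t)) ^ 2 - 1) <= K).
  { intros t. apply Rle_trans with (Rabs (2 * a * E) * (1 * (1 * 1)) + 1); [|unfold K; lra].
    apply Rabs_plus_le.
    - assert (H := Rabs_sin_le_1 (theta_t t)).
      repeat apply Rabs_mult_le; rewrite ?Rabs_R1; lra.
    - rewrite Rabs_Ropp, Rabs_R1. lra. }
  assert (HC : forall t, Rabs (2 * lam * sin (theta_t t)) <= K).
  { intros t. apply Rle_trans with (Rabs (2 * lam) * 1); [|unfold K; lra].
    apply Rabs_mult_le; [lra|apply Rabs_sin_le_1]. }
  exists (2 * K), (3 * K). split; [unfold K; lra|]. split; [unfold K; lra|split].
  - exact (trig_lipschitz _ _ _ _ K (Theta_flow_trig a E lam) HA HB).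
  - exact (trig_bounded _ _ _ _ K (Theta_flow_trig a E lam) HA HB HC).
Qed.

Lemma Omega_flow_bounds a E lam gam :
  exists L M, 0 < L /\ 0 < M /\
    lipschitz (Omega_flow a E lam gam) L /\ bounded_by (Omega_flow a E lam gam) M.
Proof.
  set (K := Rabs (2 * a) + Rabs (2 * a * E) + Rabs (2 * lam) + Rabs (2 * gam) + 1).
  assert (H1 := Rabs_pos (2 * a)). assert (H2 := Rabs_pos (2 * a * E)).
  assert (H3 := Rabs_pos (2 * lam)). assert (H4 := Rabs_pos (2 * gam)).
  assert (Hc := fun t => Rabs_cos_le_1 (atan t)). assert (Hs := fun t => Rabs_sin_le_1 (atan t)).
  assert (HA : forall t, Rabs (2 * a * sin (atan t)) <= K).
  { intros t. apply Rle_trans with (Rabs (2 * a) * 1); [|unfold K; lra].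
    apply Rabs_mult_le; [lra|apply Hs]. }
  assert (HB : forall t, Rabs (2 * lam * cos (atan t)) <= K).
  { intros t. apply Rle_trans with (Rabs (2 * lam) * 1); [|unfold K; lra].
    apply Rabs_mult_le; [lra|apply Hc]. }
  assert (HC : forall t, Rabs (2 * gam * (sin (atan t) * cos (atan t))
                               + (cos (atan t)) ^ 2 - 2 * a * E) <= K).
  { intros t.
    apply Rle_trans with (Rabs (2 * gam) * (1 * 1) + 1 * (1 * 1) + Rabs (2 * a * E));
      [|unfold K; lra].
    repeat apply Rabs_plus_le.
    - apply Rabs_mult_le; [lra|]. now apply Rabs_mult_le.
    - repeat apply Rabs_mult_le; rewrite ?Rabs_R1; try apply Hc; lra.
    - rewrite Rabs_Ropp. lra. }
  exists (2 * K), (3 * K). split; [unfold K; lra|]. split; [unfold K; lra|split].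
  - exact (trig_lipschitz _ _ _ _ K (Omega_flow_trig a E lam gam) HA HB).
  - exact (trig_bounded _ _ _ _ K (Omega_flow_trig a E lam gam) HA HB HC).
Qed.

Lemma Theta_flow_composable a E lam : composable (Theta_flow a E lam).
Proof.
  apply (trig_composable _ _ _ _ (Theta_flow_trig a E lam)); intros t;
    [ apply (continuous_comp theta_t (fun u => - 2 * a * (sin u * cos u)))
    | apply (continuous_comp theta_t (fun u => 2 * a * E * (sin u) ^ 2 - 1))
    | apply (continuous_comp theta_t (fun u => 2 * lam * sin u)) ];
    try apply theta_t_continuous;
    apply (ex_derive_continuous (V := R_NormedModule)); auto_derive; trivial.
Qed.

Lemma Omega_flow_composable a E lam gam : composable (Omega_flow a E lam gam).
Proof.
  apply (trig_composable _ _ _ _ (Omega_flow_trig a E lam gam)); intros t;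
    [ apply (continuous_comp atan (fun u => 2 * a * sin u))
    | apply (continuous_comp atan (fun u => 2 * lam * cos u))
    | apply (continuous_comp atan
        (fun u => 2 * gam * (sin u * cos u) + (cos u) ^ 2 - 2 * a * E)) ];
    try apply atan_continuous;
    apply (ex_derive_continuous (V := R_NormedModule)); auto_derive; trivial.
Qed.

Lemma Theta_flow_node a E lam : node (Theta_flow a E lam) 0.
Proof.
  apply (trig_node _ _ _ _ (- 2 * a * (sin 0 * cos 0)) (2 * a * E * (sin 0) ^ 2 - 1)
           (2 * lam * sin 0) 0 (Theta_flow_trig a E lam));
    [ apply (is_lim_comp_continuous_m_infty (fun u => - 2 * a * (sin u * cos u)))
    | apply (is_lim_comp_continuous_m_infty (fun u => 2 * a * E * (sin u) ^ 2 - 1))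
    | apply (is_lim_comp_continuous_m_infty (fun u => 2 * lam * sin u))
    | rewrite sin_0, cos_0; ring
    | rewrite sin_0, cos_0; simpl; lra ];
    try apply theta_t_left;
    apply (ex_derive_continuous (V := R_NormedModule)); auto_derive; trivial.
Qed.

(** At [xi = - PI / 2] the equation becomes [x' = - 2 a (cos x + E)]. Its linearization [2 a sin x]
    is negative at [- PI + acos E] because [-1 < E < 1]. *)
Lemma Omega_flow_node a E lam gam :
  0 < a -> -1 < E < 1 -> node (Omega_flow a E lam gam) (- PI + acos E).
Proof.
  intros Ha HE.
  assert (Hcos : cos (- PI + acos E) = - E).
  { rewrite cos_plus, cos_neg, sin_neg, cos_PI, sin_PI, cos_acos by lra. ring. }
  assert (Hsin : sin (- PI + acos E) < 0).
  { rewrite sin_plus, cos_neg, sin_neg, cos_PI, sin_PI.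
    assert (H := acos_bound_lt E HE). assert (Hs := sin_gt_0 (acos E)). lra. }
  assert (Hs0 : sin (- (PI / 2)) = - 1) by (rewrite sin_neg, sin_PI2; ring).
  assert (Hc0 : cos (- (PI / 2)) = 0) by (rewrite cos_neg, cos_PI2; ring).
  set (th := - (PI / 2)) in *.
  apply (trig_node _ _ _ _ (2 * a * sin th) (2 * lam * cos th)
     (2 * gam * (sin th * cos th) + (cos th) ^ 2 - 2 * a * E) _ (Omega_flow_trig a E lam gam));
    [ apply (is_lim_comp_continuous_m_infty (fun u => 2 * a * sin u))
    | apply (is_lim_comp_continuous_m_infty (fun u => 2 * lam * cos u))
    | apply (is_lim_comp_continuous_m_infty
        (fun u => 2 * gam * (sin u * cos u) + (cos u) ^ 2 - 2 * a * E))
    | rewrite Hcos, Hs0, Hc0; ring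
    | rewrite Hcos, Hs0, Hc0; nra ];
    try apply atan_left;
    apply (ex_derive_continuous (V := R_NormedModule)); auto_derive; trivial.
Qed.

(** * The emanating orbits as functions of the parameters *)

(** Chosen by Hilbert's epsilon so that the orbit can be varied with [E] and [lam]. The choice is
    determined: [left_orbit_close] applied to the same equation shows that two emanating orbits
    agree. *)
Definition Theta_orbit (a E lam : R) : R -> R :=
  epsilon (inhabits (fun _ => 0)) (left_orbit (Theta_flow a E lam) 0).

Definition Omega_orbit (a E lam gam : R) : R -> R :=
  epsilon (inhabits (fun _ => 0))
    (left_orbit (Omega_flow a E lam gam) (- PI + acos E)).

Lemma Theta_orbit_spec a E lam :
  left_orbit (Theta_flow a E lam) 0 (Theta_orbit a E lam).
Proof.
  apply (epsilon_spec (inhabits (fun _ => 0)) (left_orbit (Theta_flow a E lam) 0)).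
  destruct (Theta_flow_bounds a E lam) as (L & M & HL0 & HM0 & HL & HM).
  apply (left_orbit_exists _ 0 L M); try assumption;
    [apply Theta_flow_composable|apply Theta_flow_node].
Qed.

Lemma Omega_orbit_spec a E lam gam :
  0 < a -> -1 < E < 1 ->
  left_orbit (Omega_flow a E lam gam) (- PI + acos E) (Omega_orbit a E lam gam).
Proof.
  intros Ha HE.
  apply (epsilon_spec (inhabits (fun _ => 0))
           (left_orbit (Omega_flow a E lam gam) (- PI + acos E))).
  destruct (Omega_flow_bounds a E lam gam) as (L & M & HL0 & HM0 & HL & HM).
  apply (left_orbit_exists _ (- PI + acos E) L M); try assumption;
    [apply Omega_flow_composable|now apply Omega_flow_node].
Qed.

Lemma Theta_orbit_continuous a E lam e :
  0 < a < 1 / 2 -> 0 < e ->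
  exists d, 0 < d /\ forall E' lam', Rabs (E' - E) < d -> Rabs (lam' - lam) < d ->
    Rabs (Theta_orbit a E' lam' 0 - Theta_orbit a E lam 0) <= e.
Proof.
  intros Ha He. destruct (Theta_flow_bounds a E lam) as (L & M & HL0 & _ & HL & _).
  destruct (left_orbit_close _ 0 _ L 0 e (Theta_flow_node a E lam)
    (Theta_orbit_spec a E lam) HL0 HL He) as (delta & Hdelta & H).
  (* The right-hand side is affine in the parameters and [2 a <= 1], so it moves by at most
     [delta / 4 + 2 * delta / 4]. *)
  exists (delta / 4). split; [lra|]. intros E' lam' HE Hlam.
  apply (H (Theta_flow a E' lam') 0); [|rewrite Rminus_diag, Rabs_R0; lra|apply Theta_orbit_spec].
  intros t u. unfold Theta_flow, Theta_rhs.
  match goal with |- Rabs ?X <= _ => replace X with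
    (2 * a * ((E' - E) * (sin (theta_t t) ^ 2 * sin u)) + 2 * ((lam' - lam) * sin (theta_t t)))
    by ring end.
  assert (Hs := Rabs_sin_le_1).
  apply Rle_trans with (1 * (delta / 4 * (1 * (1 * 1) * 1)) + 2 * (delta / 4 * 1)); [|lra].
  apply Rabs_plus_le; repeat apply Rabs_mult_le; rewrite ?Rabs_R1; try apply Hs; try lra;
    rewrite Rabs_pos_eq; lra.
Qed.

Lemma Omega_orbit_continuous a E lam gam e :
  0 < a < 1 / 2 -> -1 < E < 1 -> 0 < e ->
  exists d, 0 < d /\ forall E' lam', Rabs (E' - E) < d -> Rabs (lam' - lam) < d ->
    Rabs (Omega_orbit a E' lam' gam 0 - Omega_orbit a E lam gam 0) <= e.
Proof.
  intros Ha HE He. destruct (Omega_flow_bounds a E lam gam) as (L & M & HL0 & _ & HL & _).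
  destruct (left_orbit_close _ (- PI + acos E) _ L 0 e (Omega_flow_node a E lam gam (proj1 Ha) HE)
    (Omega_orbit_spec a E lam gam (proj1 Ha) HE) HL0 HL He) as (delta & Hdelta & H).
  assert (Hacos : continuity_pt acos E)
    by (apply derivable_continuous_pt, derivable_pt_acos, HE).
  destruct (proj1 (continuity_pt_locally acos E) Hacos (mkposreal delta Hdelta)) as [d1 Hd1].
  (* [d1] controls the motion of the equilibrium through [acos]; the last two terms keep [E'] inside
     [(-1, 1)]. *)
  set (d := Rmin (delta / 4) (Rmin d1 (Rmin (1 - E) (1 + E)))).
  assert (Hd1' := cond_pos d1).
  assert (Hda : d <= delta / 4) by apply Rmin_l.
  assert (Hdb : d <= d1) by (eapply Rle_trans; [apply Rmin_r|apply Rmin_l]).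
  assert (Hdc : d <= 1 - E)
    by (eapply Rle_trans; [apply Rmin_r|eapply Rle_trans; [apply Rmin_r|apply Rmin_l]]).
  assert (Hdd : d <= 1 + E)
    by (eapply Rle_trans; [apply Rmin_r|eapply Rle_trans; [apply Rmin_r|apply Rmin_r]]).
  exists d. split.
  { unfold d. repeat apply Rmin_pos; lra. }
  intros E' lam' HE' Hlam.
  apply (H (Omega_flow a E' lam' gam) (- PI + acos E')).
  - intros t u. unfold Omega_flow, Omega_rhs.
    match goal with |- Rabs ?X <= _ => replace X with
      (2 * ((lam' - lam) * (cos (atan t) * sin u)) + - (2 * a * (E' - E))) by ring end.
    apply Rle_trans with (2 * (delta / 4 * (1 * 1)) + 1 * (delta / 4)); [|lra].
    apply Rabs_plus_le; [|rewrite Rabs_Ropp]; repeat apply Rabs_mult_le;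
      try apply Rabs_sin_le_1; try apply Rabs_cos_le_1; try lra; rewrite Rabs_pos_eq; lra.
  - replace (- PI + acos E' - (- PI + acos E)) with (acos E' - acos E) by ring.
    left. apply (Hd1 E'). change (Rabs (E' - E) < d1). lra.
  - apply Omega_orbit_spec; [lra|]. apply Rabs_def2 in HE'. lra.
Qed.

(** [lam] enters through [2 lam sin theta] with [sin theta > 0], so the orbit for [lam'] is a strict
    supersolution for [lam]. *)
Lemma Theta_orbit_increasing a E lam lam' :
  lam < lam' -> Theta_orbit a E lam 0 < Theta_orbit a E lam' 0.
Proof.
  intros Hlam. destruct (Theta_orbit_spec a E lam') as [Hy Hyl].
  apply (left_orbit_upper (Theta_flow a E lam) 0 _ _
           (fun t => Theta_flow a E lam' t (Theta_orbit a E lam' t))).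
  - apply Theta_flow_node.
  - apply Theta_orbit_spec.
  - exact Hyl.
  - intros t _. apply Hy.
  - intros t _. unfold Theta_flow, Theta_rhs.
    assert (Hb := theta_t_bounds t). assert (Hs := sin_gt_0 (theta_t t)). nra.
Qed.

Lemma opp_theta_t_derive t : is_derive (fun u => - theta_t u) t (- sin (theta_t t)).
Proof. apply (is_derive_opp theta_t), theta_t_derive. Qed.

Lemma opp_theta_t_left : is_lim (fun t => - theta_t t) m_infty 0.
Proof. rewrite <- Ropp_0. apply is_lim_negate, theta_t_left. Qed.

(** The curve [Theta = - theta] joins the two saddles; this is its defect as a solution. At
    [lam = -1 + a] the bracket is [a (1 - E) sin^2 theta], at [lam = -1 - a] it is [- a ((1 + E)
    sin^2 theta + 2 cos^2 theta)], whence a lower and an upper barrier. *)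
Lemma Theta_flow_opp_theta_t a E lam t :
  Theta_flow a E lam t (- theta_t t) - - sin (theta_t t) =
  2 * sin (theta_t t) *
    (1 + lam - a * ((cos (theta_t t)) ^ 2 + E * (sin (theta_t t)) ^ 2)).
Proof.
  unfold Theta_flow, Theta_rhs. rewrite cos_neg, sin_neg. ring.
Qed.

Lemma sin2_cos2_pow x : (cos x) ^ 2 = 1 - (sin x) ^ 2.
Proof. assert (H := sin2_cos2 x). unfold Rsqr in H. simpl. lra. Qed.

Lemma Theta_orbit_high a E :
  0 < a -> E < 1 -> - (PI / 2) < Theta_orbit a E (- 1 + a) 0.
Proof.
  intros Ha HE. rewrite <- theta_t_0.
  apply (left_orbit_lower (Theta_flow a E (- 1 + a)) 0 _ (fun t => - theta_t t)
           (fun t => - sin (theta_t t))).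
  - apply Theta_flow_node.
  - apply Theta_orbit_spec.
  - apply opp_theta_t_left.
  - intros t _. apply opp_theta_t_derive.
  - intros t _. apply Rlt_0_minus. rewrite Theta_flow_opp_theta_t, sin2_cos2_pow.
    assert (Hb := theta_t_bounds t). assert (Hs := sin_gt_0 (theta_t t) ltac:(lra) ltac:(lra)).
    set (s := sin (theta_t t)) in *.
    replace (2 * s * (1 + (- 1 + a) - a * (1 - s ^ 2 + E * s ^ 2)))
      with (2 * a * (1 - E) * s ^ 3) by ring.
    apply Rmult_lt_0_compat; [nra|now apply pow_lt].
Qed.

Lemma Theta_orbit_low a E :
  0 < a -> -1 < E -> Theta_orbit a E (- 1 - a) 0 < - (PI / 2).
Proof.
  intros Ha HE. rewrite <- theta_t_0.
  apply (left_orbit_upper (Theta_flow a E (- 1 - a)) 0 _ (fun t => - theta_t t)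
           (fun t => - sin (theta_t t))).
  - apply Theta_flow_node.
  - apply Theta_orbit_spec.
  - apply opp_theta_t_left.
  - intros t _. apply opp_theta_t_derive.
  - intros t _. apply Rlt_0_minus.
    assert (H := Theta_flow_opp_theta_t a E (- 1 - a) t). rewrite sin2_cos2_pow in H.
    assert (Hb := theta_t_bounds t). assert (Hs := sin_gt_0 (theta_t t) ltac:(lra) ltac:(lra)).
    set (s := sin (theta_t t)) in *.
    assert (Hs1 : s <= 1) by apply SIN_bound.
    replace (2 * s * (1 + (- 1 - a) - a * (1 - s ^ 2 + E * s ^ 2)))
      with (- (2 * a * s * ((1 + E) * s ^ 2 + 2 * (1 - s ^ 2)))) in H by ring.
    assert (0 < 2 * a * s * ((1 + E) * s ^ 2 + 2 * (1 - s ^ 2))); [|lra].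
    assert (0 < a * s) by nra. assert (0 < s ^ 2) by (now apply pow_lt).
    assert (0 <= 1 - s ^ 2) by nra.
    apply Rmult_lt_0_compat; nra.
Qed.

(** * Reflection symmetry and matching at time zero *)

Lemma solves_reflect (f g : R -> R -> R) x :
  (forall t u, g t (- PI - u) = f (- t) u) -> solves f x ->
  solves g (fun t => - PI - x (- t)).
Proof.
  intros Hfg Hx t. rewrite Hfg. assert (H := Hx (- t)).
  auto_derive; [eexists; eassumption|]. replace_derive H. ring.
Qed.

Lemma cos_reflect u : cos (- PI - u) = - cos u.
Proof. rewrite cos_minus, cos_neg, sin_neg, cos_PI, sin_PI. ring. Qed.

Lemma sin_reflect u : sin (- PI - u) = sin u.
Proof. rewrite sin_minus, cos_neg, sin_neg, cos_PI, sin_PI. ring. Qed.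

Lemma Theta_flow_reflect a E lam t u :
  Theta_flow a E lam t (- PI - u) = Theta_flow a E lam (- t) u.
Proof.
  unfold Theta_flow, Theta_rhs. rewrite cos_reflect, sin_reflect, theta_t_opp.
  rewrite <- Rtrigo_facts.sin_pi_minus, (Rtrigo_facts.cos_pi_minus (theta_t t)).
  rewrite <- (Rtrigo_facts.sin_pi_minus (PI - theta_t t)).
  replace (PI - (PI - theta_t t)) with (theta_t t) by ring. ring.
Qed.

Lemma Omega_flow_reflect a E lam gam t u :
  Omega_flow a E lam gam t (- PI - u) = Omega_flow a E lam (- gam) (- t) u.
Proof.
  unfold Omega_flow, Omega_rhs.
  rewrite cos_reflect, sin_reflect, atan_opp, cos_neg, sin_neg. ring.
Qed.

(** [- PI / 2] is the fixed point of [u -> - PI - u], so the orbit and its reflection agree at [0],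
    hence everywhere; the limit at [+oo] is the reflected one. *)
Lemma Theta_connector_intro a E lam :
  Theta_orbit a E lam 0 = - (PI / 2) -> Theta_connector a E lam.
Proof.
  intros H0. set (x := Theta_orbit a E lam) in *.
  destruct (Theta_orbit_spec a E lam) as [Hx Hxl]. fold x in Hx, Hxl.
  destruct (Theta_flow_bounds a E lam) as (L & M & _ & _ & HL & _).
  assert (Hsym : forall t, x t = - PI - x (- t)).
  { apply (solution_unique _ _ x (fun t => - PI - x (- t)) 0 HL Hx).
    - apply (solves_reflect (Theta_flow a E lam)); [apply Theta_flow_reflect|exact Hx].
    - rewrite Ropp_0, H0. lra. }
  exists theta_t, x.
  split; [exact theta_t_bounds|]. split; [exact theta_t_derive|]. split; [exact Hx|].
  split; [exact theta_t_left|]. split; [exact Hxl|]. split; [exact theta_t_right|].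
  replace (Finite (- PI)) with (Finite (- PI - 0)) by (f_equal; ring).
  now apply (is_lim_p_infty_reverse x x).
Qed.

(** The gap at time [0] between the orbit leaving the left saddle and the reflected orbit for
    [- gam], which is one that tends to the right saddle [- acos E]. *)
Definition Omega_mismatch (a E lam gam : R) : R :=
  Omega_orbit a E lam gam 0 + Omega_orbit a E lam (- gam) 0 + PI.

Lemma Omega_reflected_solves a E lam gam :
  0 < a -> -1 < E < 1 ->
  solves (Omega_flow a E lam gam) (fun t => - PI - Omega_orbit a E lam (- gam) (- t)).
Proof.
  intros Ha HE. apply (solves_reflect (Omega_flow a E lam (- gam))).
  - intros t u. apply Omega_flow_reflect.
  - now apply Omega_orbit_spec.
Qed.

Lemma Omega_reflected_right a E lam gam :
  0 < a -> -1 < E < 1 ->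
  is_lim (fun t => - PI - Omega_orbit a E lam (- gam) (- t)) p_infty (- acos E).
Proof.
  intros Ha HE.
  replace (Finite (- acos E)) with (Finite (- PI - (- PI + acos E))) by (f_equal; ring).
  apply (is_lim_p_infty_reverse _ (Omega_orbit a E lam (- gam))); [reflexivity|].
  now apply Omega_orbit_spec.
Qed.

Lemma Omega_connector_intro a E lam gam :
  0 < a -> -1 < E < 1 -> Omega_mismatch a E lam gam = 0 -> Omega_connector a E lam gam.
Proof.
  intros Ha HE H0. unfold Omega_mismatch in H0.
  destruct (Omega_orbit_spec a E lam gam Ha HE) as [Hx Hxl].
  set (x := Omega_orbit a E lam gam) in *.
  destruct (Omega_flow_bounds a E lam gam) as (L & M & _ & _ & HL & _).
  assert (Hsym : forall t, x t = - PI - Omega_orbit a E lam (- gam) (- t)).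
  { apply (solution_unique _ _ x (fun t => - PI - Omega_orbit a E lam (- gam) (- t)) 0 HL Hx).
    - now apply Omega_reflected_solves.
    - rewrite Ropp_0. lra. }
  exists atan, x.
  split; [intros t; assert (H := atan_bound t); lra|]. split; [exact atan_derive|]. split; [exact Hx|].
  split; [exact atan_left|]. split; [exact Hxl|]. split; [exact atan_right|].
  apply (is_lim_ext (fun t => - PI - Omega_orbit a E lam (- gam) (- t))).
  - intros t. symmetry. apply Hsym.
  - now apply Omega_reflected_right.
Qed.

(** * The two connectors *)

(** At [E = 0] the equilibrium is [- PI / 2] itself, and on this constant the flow equals
    [c (- 2 lam + 2 gam s + c)] with [c = cos xi > 0]; here [- 2 lam >= 1] outweighs [2 |gam|]. *)
Lemma Omega_orbit_above_half_turn a lam gam :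
  0 < a -> Rabs gam < 1 / 2 -> lam <= - (1 / 2) ->
  - (PI / 2) < Omega_orbit a 0 lam gam 0.
Proof.
  intros Ha Hg Hlam.
  apply (left_orbit_lower (Omega_flow a 0 lam gam) (- PI + acos 0) _
           (fun _ => - (PI / 2)) (fun _ => 0)).
  - apply Omega_flow_node; lra.
  - apply Omega_orbit_spec; lra.
  - rewrite acos_0. replace (- PI + PI / 2) with (- (PI / 2)) by lra. apply is_lim_const.
  - intros t _. apply is_derive_Reals, derivable_pt_lim_const.
  - intros t _. unfold Omega_flow, Omega_rhs.
    rewrite cos_neg, sin_neg, cos_PI2, sin_PI2.
    assert (Hb := atan_bound t).
    assert (Hc := cos_gt_0 (atan t) ltac:(lra) ltac:(lra)).
    assert (Hs := Rabs_mult_le _ _ _ _ (Rlt_le _ _ Hg) (Rabs_sin_le_1 (atan t))).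
    apply Rabs_le_between in Hs.
    set (c := cos (atan t)) in *. set (s := sin (atan t)) in *.
    replace (2 * a * s * 0 + 2 * lam * c * - (1) + 2 * gam * s * c + c ^ 2 - 2 * a * 0)
      with (c * (- 2 * lam + 2 * (gam * s) + c)) by ring.
    apply Rmult_lt_0_compat; lra.
Qed.

Lemma Omega_mismatch_low a lam gam :
  0 < a -> Rabs gam < 1 / 2 -> lam <= - (1 / 2) -> 0 < Omega_mismatch a 0 lam gam.
Proof.
  intros Ha Hg Hlam. unfold Omega_mismatch.
  assert (H1 := Omega_orbit_above_half_turn a lam gam Ha Hg Hlam).
  assert (H2 := Omega_orbit_above_half_turn a lam (- gam) Ha ltac:(now rewrite Rabs_Ropp) Hlam).
  lra.
Qed.

(** * Negative mismatch for energies close to one *)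

Lemma cos_atan_bounds t : 1 <= t -> / (2 * t) <= cos (atan t) <= / t.
Proof.
  intros Ht. rewrite cos_atan. unfold Rdiv. rewrite Rmult_1_l.
  assert (H : 0 < 1 + t²) by (assert (H := Rle_0_sqr t); lra).
  assert (Hs := sqrt_lt_R0 _ H).
  split; apply Rinv_le_contravar; try lra.
  - rewrite <- (sqrt_Rsqr (2 * t)) by lra. apply sqrt_le_1_alt. unfold Rsqr. nra.
  - rewrite <- (sqrt_Rsqr t) at 1 by lra. apply sqrt_le_1_alt. lra.
Qed.

Lemma sin_atan_ge t g : 0 < g < 1 / 2 -> 4 / g <= t ->
  3 / 4 <= sin (atan t) /\ cos (atan t) <= g / 4.
Proof.
  intros Hg Ht.
  assert (H4g : 8 <= 4 / g).
  { apply (Rmult_le_reg_r g); [lra|]. replace (4 / g * g) with 4 by (field; lra). lra. }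
  assert (Hc := cos_atan_bounds t ltac:(lra)).
  assert (Hcg : cos (atan t) <= g / 4).
  { apply Rle_trans with (/ t); [lra|].
    replace (g / 4) with (/ (4 / g)) by (field; lra). apply Rinv_le_contravar; lra. }
  assert (Hpos : 0 < / (2 * t)) by (apply Rinv_0_lt_compat; lra).
  split; [|assumption].
  assert (Hs : 0 < sin (atan t)).
  { rewrite sin_atan. apply Rdiv_lt_0_compat; [lra|]. apply sqrt_lt_R0.
    assert (H := Rle_0_sqr t). lra. }
  assert (H := sin2_cos2_pow (atan t)). nra.
Qed.

(* The Coulomb term [2 gam sin xi cos xi] decays only like [1/t] and so
   dominates on [[-g/12, pi/2]] once [t >= 4/g]. *)
Lemma Omega_flow_drift a E lam g t z :
  0 < a -> 0 < g < 1 / 2 -> - (3 / 2) <= lam <= 0 -> 4 / g <= t ->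
  - (g / 12) <= z <= PI / 2 ->
  Omega_flow a E lam (- g) t z <=
    2 * a * (cos z - E) - g * cos (atan t).
Proof.
  intros Ha Hg Hlam Ht Hz. unfold Omega_flow, Omega_rhs.
  destruct (sin_atan_ge t g Hg Ht) as [Hs Hc].
  assert (Hb := atan_bound t).
  assert (Hc0 := cos_gt_0 (atan t) ltac:(lra) ltac:(lra)).
  assert (Hs1 : sin (atan t) <= 1) by apply SIN_bound.
  assert (HPI := PI2_1).
  assert (Hcz : 0 <= cos z) by (apply cos_ge_0; lra).
  assert (Hsz : - (g / 12) <= sin z).
  { destruct (Rle_dec 0 z) as [H0|H0].
    - assert (0 <= sin z) by (apply sin_ge_0; lra). lra.
    - assert (H := sin_lipschitz z 0). rewrite sin_0, !Rminus_0_r, (Rabs_left z) in H by lra.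
      apply Rabs_le_between in H. lra. }
  set (c := cos (atan t)) in *. set (s := sin (atan t)) in *.
  assert (H1 : 2 * a * s * cos z <= 2 * a * cos z).
  { apply Rmult_le_compat_r; [assumption|]. nra. }
  assert (H2 : - lam * (- sin z) <= g / 8) by nra.
  (* The three terms are at most [g / 4], [- 3 g / 2] and [g / 4]. *)
  assert (H3 : 2 * lam * sin z + 2 * - g * s + c <= - g) by nra.
  assert (H4 : c * (2 * lam * sin z + 2 * - g * s + c) <= c * - g)
    by (apply Rmult_le_compat_l; lra).
  simpl. nra.
Qed.

(** The constant [PI / 2] is an upper barrier: the flow there is at most [c (2 a - 1 + 2 g) - 2 a E]
    with [0 < c <= 1], and [2 a (1 - E) < 1 - 2 g] makes this negative. *)
Lemma Omega_orbit_le_half_pi a E lam g t :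
  0 < a < 1 / 2 -> 0 < g < 1 / 2 -> -1 < E < 1 -> lam <= - 1 + a -> 0 < E ->
  2 * a * (1 - E) < 1 - 2 * g -> Omega_orbit a E lam (- g) t <= PI / 2.
Proof.
  intros Ha Hg HE Hlam HE0 Hsmall.
  destruct (Omega_orbit_spec a E lam (- g) ltac:(lra) HE) as [Hx Hxl].
  assert (HPI := PI_RGT_0). assert (Hac := acos_bound E).
  (* The starting equilibrium [- PI + acos E] is at most [0], so tolerance [PI / 2] puts the orbit
     below the barrier in the far past. *)
  rewrite is_lim_m_infty_iff in Hxl. destruct (Hxl (PI / 2)) as [T HT]; [lra|].
  set (S := Rmin T t).
  apply (upper_barrier_const _ _ _ S t (Rmin_r _ _) Hx).
  - intros u _. unfold Omega_flow, Omega_rhs. rewrite cos_PI2, sin_PI2.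
    assert (Hb := atan_bound u).
    assert (Hc := cos_gt_0 (atan u) ltac:(lra) ltac:(lra)).
    assert (Hc1 : cos (atan u) <= 1) by apply COS_bound.
    assert (Hs : - 1 <= sin (atan u)) by apply SIN_bound.
    set (c := cos (atan u)) in *. set (s := sin (atan u)) in *.
    assert (H1 : 2 * lam + 2 * - g * s + c <= 2 * a - 1 + 2 * g) by nra.
    assert (H2 : c * (2 * lam + 2 * - g * s + c) <= c * (2 * a - 1 + 2 * g))
      by (apply Rmult_le_compat_l; lra).
    assert (H3 : c * (2 * a - 1 + 2 * g) < 2 * a * E).
    { destruct (Rle_dec 0 (2 * a - 1 + 2 * g)); nra. }
    simpl. nra.
  - assert (H := HT S (Rmin_l _ _)). apply Rabs_def2 in H. lra.
Qed.

(** The orbit is at most [PI / 2] at [t1], descends below a logarithmic barrier to [- z1] at [t2],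
    and is trapped there because [cos z1 < E]. As [acos E < z1], it ends below the orbit tending to
    [- acos E], so it lies below it at time [0] too. [E] is fixed before [lam], since [lam] will
    later depend on [E]. *)
Lemma Omega_mismatch_high a g :
  0 < a < 1 / 2 -> 0 < g < 1 / 2 ->
  exists E, 0 < E < 1 /\ forall lam, - 1 - a <= lam <= - 1 + a ->
    Omega_mismatch a E lam (- g) < 0.
Proof.
  intros Ha Hg.
  assert (HPI := PI2_1).
  assert (H4g : 8 <= 4 / g).
  { apply (Rmult_le_reg_r g); [lra|]. replace (4 / g * g) with 4 by (field; lra). lra. }
  set (t1 := 4 / g) in *. set (z1 := g / 12).
  assert (Hz1 : 0 < z1 < 1) by (unfold z1; lra).
  (* Chosen so that [g / 8 * ln (t2 / t1)] is the whole descent from [PI / 2] to [- z1]. *)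
  set (P := 8 * (PI / 2 + z1) / g).
  assert (HP : 0 < P) by (apply Rdiv_lt_0_compat; lra).
  set (t2 := t1 * exp P).
  assert (HeP : 1 < exp P) by (rewrite <- exp_0; now apply exp_increasing).
  assert (Ht12 : t1 < t2) by (unfold t2; nra).
  assert (Hcosz1 : 0 < cos z1 < 1).
  { split; [apply cos_gt_0; lra|]. rewrite <- cos_0. apply cos_decreasing_1; lra. }
  (* The three bounds serve the trap at [- z1], the dominance of the Coulomb term up to [t2], and
     the barrier at [PI / 2]; halving makes them strict. *)
  set (eps := Rmin (1 - cos z1) (Rmin (g / (4 * t2)) (1 - 2 * g)) / 2).
  assert (Hgt2 : 0 < g / (4 * t2)) by (apply Rdiv_lt_0_compat; lra).
  assert (Heps : 0 < eps).
  { unfold eps. apply Rdiv_lt_0_compat; [|lra]. repeat apply Rmin_pos; lra. }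
  assert (Heps1 : 2 * eps <= 1 - cos z1).
  { unfold eps. assert (H := Rmin_l (1 - cos z1) (Rmin (g / (4 * t2)) (1 - 2 * g))). lra. }
  assert (Heps2 : 2 * eps <= Rmin (g / (4 * t2)) (1 - 2 * g)).
  { unfold eps. assert (H := Rmin_r (1 - cos z1) (Rmin (g / (4 * t2)) (1 - 2 * g))). lra. }
  assert (Heps3 := Rle_trans _ _ _ Heps2 (Rmin_l _ _)).
  assert (Heps4 := Rle_trans _ _ _ Heps2 (Rmin_r _ _)).
  set (E := 1 - eps).
  assert (HE : 0 < E < 1) by (unfold E; lra).
  exists E. split; [assumption|]. intros lam Hlam.
  assert (HE' : -1 < E < 1) by lra.
  assert (Ha0 : 0 < a) by lra.
  assert (HaE : 2 * a * (1 - E) <= eps) by (unfold E; nra).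
  destruct (Omega_orbit_spec a E lam (- g) Ha0 HE') as [Hx _].
  set (x := Omega_orbit a E lam (- g)) in *.
  assert (Hx1 : x t1 <= PI / 2) by (apply Omega_orbit_le_half_pi; lra).
  (* Its slope is [- g / (8 t)], whereas the flow up to [t2] is at most [g / (8 t) - g / (2 t)]. *)
  set (z := fun t => PI / 2 - g / 8 * ln (t / t1)).
  assert (Hz1' : z t1 = PI / 2).
  { unfold z. rewrite Rdiv_diag, ln_1 by lra. ring. }
  assert (Hz2 : z t2 = - z1).
  { unfold z, t2. replace (t1 * exp P / t1) with (exp P) by (field; lra).
    rewrite ln_exp. unfold P. field. lra. }
  assert (Hzd : forall t, 0 < t -> is_derive z t (- (g / 8 * / t))).
  { intros t Ht. unfold z. auto_derive.
    - apply Rdiv_lt_0_compat; lra.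
    - field. lra. }
  assert (Hzdec : forall s t, 0 < s -> s <= t -> z t <= z s).
  { intros s t Hs Hst. unfold z. apply Rplus_le_compat_l, Ropp_le_contravar.
    apply Rmult_le_compat_l; [lra|]. apply ln_le; [apply Rdiv_lt_0_compat; lra|].
    apply Rmult_le_compat_r; [left; apply Rinv_0_lt_compat; lra|assumption]. }
  assert (Hx2 : x t2 <= - z1).
  { rewrite <- Hz2. apply (upper_barrier _ _ z (fun t => - (g / 8 * / t)) t1 t2 ltac:(lra) Hx).
    - intros t Ht. apply Hzd. lra.
    - intros t Ht.
      assert (Hzt1 := Hzdec t1 t ltac:(lra) ltac:(lra)).
      assert (Hzt2 := Hzdec t t2 ltac:(lra) ltac:(lra)).
      assert (Hd := Omega_flow_drift a E lam g t (z t) Ha0 Hg ltac:(lra) ltac:(apply Ht)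
        ltac:(unfold z1 in *; lra)).
      assert (Hc := cos_atan_bounds t ltac:(lra)).
      assert (Hcz : cos (z t) <= 1) by apply COS_bound.
      assert (Hac : 2 * a * (cos (z t) - E) <= 2 * a * (1 - E))
        by (apply Rmult_le_compat_l; lra).
      assert (Hit : g / (4 * t2) <= g / 4 * / t).
      { replace (g / (4 * t2)) with (g / 4 * / t2) by (field; lra).
        apply Rmult_le_compat_l; [lra|]. apply Rinv_le_contravar; lra. }
      assert (Hgc : g / 2 * / t <= g * cos (atan t)).
      { replace (g / 2 * / t) with (g * / (2 * t)) by (field; lra).
        apply Rmult_le_compat_l; lra. }
      assert (0 < g * / t) by (apply Rmult_lt_0_compat; [lra|apply Rinv_0_lt_compat; lra]).
      lra.
    - lra. }
  assert (Hxlate : forall t, t2 <= t -> x t <= - z1).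
  { intros t Ht. apply (upper_barrier_const _ _ _ t2 t Ht Hx); [|assumption].
    intros u Hu.
    assert (Hd := Omega_flow_drift a E lam g u (- z1) Ha0 Hg ltac:(lra) ltac:(fold t1; lra)
        ltac:(unfold z1 in *; lra)).
    rewrite cos_neg in Hd.
    assert (Hb := atan_bound u). assert (Hc := cos_gt_0 (atan u) ltac:(lra) ltac:(lra)).
    assert (2 * a * (cos z1 - E) < 0) by (unfold E; nra). nra. }
  apply Rnot_le_lt; intros Hmis. unfold Omega_mismatch in Hmis. fold x in Hmis.
  assert (Hy := Omega_reflected_solves a E lam (- g) Ha0 HE').
  assert (Hyl := Omega_reflected_right a E lam (- g) Ha0 HE').
  set (y := fun t => - PI - Omega_orbit a E lam (- - g) (- t)) in *.
  assert (Hacos : acos E < z1).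
  { destruct (acos_bound_lt E HE') as [H0 H1]. apply Rnot_le_lt; intros Hle.
    assert (Hcos : cos (acos E) <= cos z1) by (apply cos_decr_1; lra).
    rewrite cos_acos in Hcos by lra. unfold E in Hcos. lra. }
  apply is_lim_spec in Hyl.
  destruct (Hyl (mkposreal (z1 - acos E) ltac:(lra))) as [T HT].
  set (t := Rmax t2 (T + 1)).
  assert (HtT := Rmax_r t2 (T + 1)). fold t in HtT.
  assert (Hyt := HT t ltac:(lra)). simpl in Hyt. apply Rabs_def2 in Hyt.
  assert (Hxt := Hxlate t (Rmax_l _ _)).
  destruct (Omega_flow_bounds a E lam (- g)) as (L & M & _ & _ & HL & _).
  (* A nonnegative mismatch means [y 0 <= x 0], and order is preserved; at the late time [t],
     however, [x t <= - z1 < y t]. *)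
  assert (y t <= x t); [|lra].
  apply (solution_monotone _ L y x 0 t HL Hy Hx).
  unfold y. rewrite Ropp_0. lra.
Qed.

(** * The curve of connecting values [lam] and the intermediate value argument in [E] *)

Lemma continuity_pt_le (F : R -> R) x :
  (forall e, 0 < e -> exists d, 0 < d /\ forall u, Rabs (u - x) < d -> Rabs (F u - F x) <= e) ->
  continuity_pt F x.
Proof.
  intros H. apply continuity_pt_locally. intros e.
  destruct (H (e / 2)) as [d [Hd HF]]; [assert (He := cond_pos e); lra|].
  exists (mkposreal d Hd). intros u Hu.
  apply Rle_lt_trans with (e / 2); [now apply HF|]. assert (He := cond_pos e). lra.
Qed.

Lemma Theta_connecting_lam_exists a E :
  0 < a < 1 / 2 -> -1 < E < 1 ->
  exists lam, - 1 - a <= lam <= - 1 + a /\ Theta_orbit a E lam 0 = - (PI / 2).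
Proof.
  intros Ha HE.
  destruct (IVT_interv (fun lam => Theta_orbit a E lam 0 + PI / 2) (- 1 - a) (- 1 + a))
    as [lam [Hlam H0]].
  - intros lam _. apply continuity_pt_le. intros e He.
    destruct (Theta_orbit_continuous a E lam e Ha He) as [d [Hd H]].
    exists d. split; [assumption|]. intros u Hu.
    replace (Theta_orbit a E u 0 + PI / 2 - (Theta_orbit a E lam 0 + PI / 2))
      with (Theta_orbit a E u 0 - Theta_orbit a E lam 0) by ring.
    apply H; [now rewrite Rminus_diag, Rabs_R0|assumption].
  - lra.
  - assert (H := Theta_orbit_low a E). lra.
  - assert (H := Theta_orbit_high a E). lra.
  - exists lam. split; [assumption|lra].
Qed.

(** Strict monotonicity in [lam] makes the chosen value unique, which is why it depends continuously
    on [E]. *)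
Definition Theta_connecting_lam (a E : R) : R :=
  epsilon (inhabits 0)
    (fun lam => - 1 - a <= lam <= - 1 + a /\ Theta_orbit a E lam 0 = - (PI / 2)).

Lemma Theta_connecting_lam_spec a E :
  0 < a < 1 / 2 -> -1 < E < 1 ->
  - 1 - a <= Theta_connecting_lam a E <= - 1 + a /\
  Theta_orbit a E (Theta_connecting_lam a E) 0 = - (PI / 2).
Proof.
  intros Ha HE.
  exact (epsilon_spec (inhabits 0)
    (fun lam => - 1 - a <= lam <= - 1 + a /\ Theta_orbit a E lam 0 = - (PI / 2))
    (Theta_connecting_lam_exists a E Ha HE)).
Qed.

(** At [l - e] and [l + e] the orbit value lies strictly on either side of [- PI / 2]. This persists
    for nearby [E'], and monotonicity in [lam] at [E'] confines the new root between them. *)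
Lemma Theta_connecting_lam_continuous a E e :
  0 < a < 1 / 2 -> -1 < E < 1 -> 0 < e ->
  exists d, 0 < d /\ forall E', Rabs (E' - E) < d ->
    Rabs (Theta_connecting_lam a E' - Theta_connecting_lam a E) < e.
Proof.
  intros Ha HE He. destruct (Theta_connecting_lam_spec a E Ha HE) as [_ H0].
  set (l := Theta_connecting_lam a E) in *.
  assert (Hup := Theta_orbit_increasing a E l (l + e) ltac:(lra)).
  assert (Hlo := Theta_orbit_increasing a E (l - e) l ltac:(lra)).
  (* Half of the gap to [- PI / 2] as tolerance preserves the strict inequality. *)
  destruct (Theta_orbit_continuous a E (l + e) ((Theta_orbit a E (l + e) 0 + PI / 2) / 2)
     Ha ltac:(lra)) as [d1 [Hd1 H1]].
  destruct (Theta_orbit_continuous a E (l - e) ((- (PI / 2) - Theta_orbit a E (l - e) 0) / 2)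
     Ha ltac:(lra)) as [d2 [Hd2 H2]].
  set (d := Rmin (Rmin d1 d2) (Rmin (1 - E) (1 + E))).
  assert (Hda : d <= d1) by (eapply Rle_trans; [apply Rmin_l|apply Rmin_l]).
  assert (Hdb : d <= d2) by (eapply Rle_trans; [apply Rmin_l|apply Rmin_r]).
  assert (Hdc : d <= 1 - E) by (eapply Rle_trans; [apply Rmin_r|apply Rmin_l]).
  assert (Hdd : d <= 1 + E) by (eapply Rle_trans; [apply Rmin_r|apply Rmin_r]).
  exists d. split; [unfold d; repeat apply Rmin_pos; lra|]. intros E' HE'.
  assert (HE'' := HE'). apply Rabs_def2 in HE''.
  destruct (Theta_connecting_lam_spec a E' Ha ltac:(lra)) as [_ H0'].
  set (l' := Theta_connecting_lam a E') in *.
  assert (Hz : forall u, Rabs (u - u) = 0) by (intros; rewrite Rminus_diag; apply Rabs_R0).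
  assert (H3 := H1 E' (l + e) ltac:(lra) ltac:(rewrite Hz; lra)).
  assert (H4 := H2 E' (l - e) ltac:(lra) ltac:(rewrite Hz; lra)).
  apply Rabs_le_between in H3, H4.
  apply Rabs_def1; apply Rnot_le_lt; intros Hle.
  - destruct (Req_dec l' (l + e)) as [Heq|Hne]; [rewrite Heq in H0'; lra|].
    assert (H := Theta_orbit_increasing a E' (l + e) l' ltac:(lra)). lra.
  - destruct (Req_dec l' (l - e)) as [Heq|Hne]; [rewrite Heq in H0'; lra|].
    assert (H := Theta_orbit_increasing a E' l' (l - e) ltac:(lra)). lra.
Qed.

Lemma Omega_mismatch_continuous a gam E :
  0 < a < 1 / 2 -> -1 < E < 1 ->
  continuity_pt (fun E => Omega_mismatch a E (Theta_connecting_lam a E) gam) E.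
Proof.
  intros Ha HE. apply continuity_pt_le. intros e He.
  set (l := Theta_connecting_lam a E).
  destruct (Omega_orbit_continuous a E l gam (e / 2) Ha HE ltac:(lra)) as [d1 [Hd1 H1]].
  destruct (Omega_orbit_continuous a E l (- gam) (e / 2) Ha HE ltac:(lra)) as [d2 [Hd2 H2]].
  set (d := Rmin d1 d2). assert (Hd : 0 < d) by (now apply Rmin_pos).
  assert (Hda : d <= d1) by apply Rmin_l. assert (Hdb : d <= d2) by apply Rmin_r.
  destruct (Theta_connecting_lam_continuous a E d Ha HE Hd) as [d3 [Hd3 H3]].
  exists (Rmin d d3). split; [now apply Rmin_pos|]. intros E' HE'.
  assert (Hm1 := Rmin_l d d3). assert (Hm2 := Rmin_r d d3).
  assert (Hl := H3 E' ltac:(lra)). fold l in Hl.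
  specialize (H1 E' (Theta_connecting_lam a E') ltac:(lra) ltac:(lra)).
  specialize (H2 E' (Theta_connecting_lam a E') ltac:(lra) ltac:(lra)).
  unfold Omega_mismatch. apply Rabs_le_between in H1, H2. apply Rabs_le. lra.
Qed.

Theorem theorem9 (a gam : R) :
  0 < a < 1 / 2 ->
  - sqrt (2 * a * (1 - 2 * a)) < gam < 0 ->
  exists lam E : R,
    -1 - a <= lam <= -1 + a /\ 0 < E < 1 /\
    Theta_connector a E lam /\ Omega_connector a E lam gam.
Proof.
  intros Ha Hgam.
  (* From [2 a (1 - 2 a) <= 1 / 4]; the hypothesis on [gam] thus yields [|gam| < 1 / 2]. *)
  assert (Hsqrt : sqrt (2 * a * (1 - 2 * a)) <= 1 / 2).
  { rewrite <- (sqrt_Rsqr (1 / 2)) by lra. apply sqrt_le_1_alt.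
    assert (H := Rle_0_sqr (2 * a - 1 / 2)). unfold Rsqr in *. lra. }
  destruct (Omega_mismatch_high a (- gam) Ha ltac:(lra)) as (E1 & HE1 & Hhigh).
  rewrite Ropp_involutive in Hhigh.
  set (G := fun E => Omega_mismatch a E (Theta_connecting_lam a E) gam).
  assert (HG0 : 0 < G 0).
  { destruct (Theta_connecting_lam_spec a 0 Ha ltac:(lra)) as [Hl _].
    apply Omega_mismatch_low; [lra|rewrite Rabs_left; lra|lra]. }
  assert (HG1 : G E1 < 0).
  { apply Hhigh. apply Theta_connecting_lam_spec; lra. }
  (* [IVT_interv] expects a change from negative to positive, hence the sign. *)
  destruct (IVT_interv (fun E => - G E) 0 E1) as [E [HE HGE]]; try lra.
  { intros E HE. apply continuity_pt_opp, Omega_mismatch_continuous; lra. }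
  (* The root lies in the closed interval from [0] to [E1]; [0 < G 0] excludes the left end and
     [E1 < 1] bounds it on the right. *)
  assert (HE0 : E <> 0) by (intros ->; lra).
  destruct (Theta_connecting_lam_spec a E Ha ltac:(lra)) as [Hl HTh].
  exists (Theta_connecting_lam a E), E.
  split; [assumption|]. split; [lra|]. split.
  - now apply Theta_connector_intro.
  - apply Omega_connector_intro; try lra. unfold G in HGE. lra.
Qed.
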